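(* Let $\varphi$ be an entire function, $0\le s\le1$, $p>0$ and $\alpha>-1$, such that $p-2<\alpha<p-1$. Suppose that one of the following conditions is satisfied: (a) $\alpha<\frac{p(s+1)}2-1$; (b) $p<2$ and $\alpha=\frac{p(s+1)}2-1$. Then $S_\varphi(Q_s)\subset\mathcal{D}^p_\alpha$ if and only if $\varphi$ is constant.
   Context: $\mathbb{D}=\{z\in\mathbb{C}:|z|<1\}$, $\mathcal{H}ol(\mathbb{D})$ is the space of analytic functions in $\mathbb{D}$, and $dA(z)=\frac1\pi\,dx\,dy$. Superposition operator: for an entire function $\varphi$, $S_\varphi(f)=\varphi\circ f$ for $f\in\mathcal{H}ol(\mathbb{D})$. For $X,Y\subset\mathcal{H}ol(\mathbb{D})$, $S_\varphi(X)\subset Y$ means $\varphi\circ f\in Y$ for every $f\in X$. Spaces: for $0<p<\infty$ and $\alpha>-1$, $\mathcal{D}^p_\alpha$ is the set of $f\in\mathcal{H}ol(\mathbb{D})$ with $\int_{\mathbb{D}}(1-|z|^2)^\alpha|f'(z)|^p\,dA(z)<\infty$. For $0\le s<\infty$, $Q_s$ is the set of $f\in\mathcal{H}ol(\mathbb{D})$ with $\sup_{a\in\mathbb{D}}\int_{\mathbb{D}}|f'(z)|^2g(z,a)^s\,dA(z)<\infty$, where $g(z,a)=\log\left|\frac{1-\overline{a}z}{z-a}\right|$. *)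

(* Defs.v *)
From mathcomp Require Import all_boot all_order all_algebra.
From mathcomp Require Import complex.
From mathcomp Require Import all_classical all_reals all_analysis.

Set Implicit Arguments.
Unset Strict Implicit.
Unset Printing Implicit Defensive.

Import Order.TTheory GRing.Theory Num.Theory numFieldNormedType.Exports.
Import ComplexField.Normc.

Local Open Scope classical_set_scope.
Local Open Scope complex_scope.
Local Open Scope ring_scope.

(* The modulus is the real-valued [normc], since [`|z|] lives in [R[i]]. *)
Definition unit_disc (R : realType) : set R[i] := [set z | normc z < 1].

(* [derivable _ z 1] over the field [R[i]] is complex differentiability at z. *)
Definition holomorphic_on (R : realType) (U : set R[i]) (f : R[i] -> R[i]) : Prop :=
  forall z, U z -> derivable (f : R[i]^o -> R[i]^o) z 1.

(* An analytic function in the disc is encoded by a total function on [R[i]],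
   whose values outside the disc are never used. *)
Definition Hol (R : realType) : set (R[i] -> R[i]) :=
  [set f | holomorphic_on (@unit_disc R) f].

Definition entire (R : realType) (phi : R[i] -> R[i]) : Prop :=
  holomorphic_on setT phi.

Definition cderiv (R : realType) (f : R[i] -> R[i]) : R[i] -> R[i] :=
  derive1 (f : R[i] -> R[i]^o).

(* [\int_DD F dA] with [dA = dx dy / pi]. *)
Definition disc_integral (R : realType) (F : R[i] -> R) : \bar R :=
  ((pi^-1)%:E *
   \int[(@lebesgue_measure R \x @lebesgue_measure R)%E]_(w in
        [set w : R * R | unit_disc (w.1 +i* w.2)]) (F (w.1 +i* w.2))%:E)%E.

(* At z = a, where g is +oo, the total operations give the value 0; this
   changes the integrand defining Q_s only on a null set. *)
Definition green (R : realType) (z a : R[i]) : R :=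
  ln (normc ((1 - a^* * z) / (z - a))).

Definition weighted_Dirichlet (R : realType) (p alpha : R) : set (R[i] -> R[i]) :=
  [set f | Hol f /\
    (disc_integral
       (fun z : R[i] => ((1 - normc z ^+ 2) `^ alpha * normc (cderiv f z) `^ p)%R)
     < +oo)%E].

Definition Qspace (R : realType) (s : R) : set (R[i] -> R[i]) :=
  [set f | Hol f /\
    (ereal_sup [set disc_integral
                  (fun z : R[i] => (normc (cderiv f z) ^+ 2 * green z a `^ s)%R)
               | a in @unit_disc R]
     < +oo)%E].

Definition superposition (R : realType) (phi f : R[i] -> R[i]) : R[i] -> R[i] :=
  phi \o f.

(* Main.v *)
Require Import Defs.
From mathcomp Require Import all_boot all_order all_algebra.
From mathcomp Require Import ring lra.
From mathcomp Require Import complex.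
From mathcomp Require Import all_classical all_reals all_analysis.
From mathcomp Require Import measurable_realfun.

Import Order.TTheory GRing.Theory Num.Theory numFieldNormedType.Exports.
Import ComplexField.Normc.

Local Open Scope classical_set_scope.
Local Open Scope complex_scope.
Local Open Scope ring_scope.

(* With [beta = (1 + alpha) / p], which lies in ]0, 1[, and a large integer [N], the
   lacunary series [f] with [f'(z) = \sum_k c_k z ^ (N ^ k)] and
   [c_k ^ p = N ^ (k p beta) / (k + 1)] has a derivative that is dominated by its
   [k]-th term on the annulus where [1 - |z|] is comparable to [N ^ -k]. Summing over
   the annuli, the [D^p_alpha] integral is bounded below by a multiple of the
   harmonic series, whereas membership in [Q_s] amounts to the convergence of
   [\sum_k N ^ (k (2 beta - 1 - s)) (k + 1) ^ (- 2 / p)], which is exactly what (a)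
   or (b) provides. Moreover [f] is bounded. If the entire function [phi] is not
   constant then [|phi'|] is bounded below near some point [b], and [b + e f] with
   [e] small is a function of [Q_s] whose image under [phi] is not in [D^p_alpha].

   The Green function is handled through
   [g(z, a) <= ln (1 + (1 - |z|^2) / |z - a|)] and the estimate [C d r] for the area
   of the intersection of the annulus [1 - d <= |z| < 1] with a disc of radius [r].
   The continuity of [phi'] is obtained from Goursat's theorem. *)

Set Implicit Arguments.
Unset Strict Implicit.
Unset Printing Implicit Defensive.

(** * Complex derivatives *)

(** On the [k]-th annulus, whose area is of order [N ^ -k], the choice of [c_k ^ p] makes the
    [D^p_alpha] integral of order exactly [1 / (k + 1)]. This stays on the edge of divergence and so
    leaves room for the equality case (b), where the powers of [N] cancel in the [Q_s] series and
    [\sum_k (k + 1) ^ (- 2 / p)] remains.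

    Boundedness of [f] comes from [beta < 1]: integration divides [c_k] by about [N ^ k], which
    leaves geometric decay. This is what makes an arbitrary entire [phi] accessible, since [b + e f]
    then never leaves the small disc where [|phi'|] is controlled.

    Integrals are compared only with sums of multiples of indicator functions, so the analysis
    reduces to areas. The sets used are graphs thickened along one coordinate axis, whose area is
    given by Cavalieri's principle.

    Goursat's theorem is applied to rectangles only. Circles enter through the substitution
    [cexp w]: a circle becomes a vertical segment, and periodicity cancels the two horizontal
    sides. *)

Section ComplexNorm.
Context {R : realType}.
Implicit Types (x y z : R[i]).

Lemma normcD_le x y : normc (x + y) <= normc x + normc y.
Proof. exact: le_normcD. Qed.

Lemma normc_opp x : normc (- x) = normc x.
Proof. exact: normcN. Qed.

Lemma normcB_le x y : normc (x - y) <= normc x + normc y.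
Proof. by rewrite -(normc_opp y) normcD_le. Qed.

Lemma normc_distC x y : normc (x - y) = normc (y - x).
Proof. by rewrite -normc_opp opprB. Qed.

Lemma normc_distD z x y : normc (x - y) <= normc (x - z) + normc (z - y).
Proof. by rewrite (le_trans _ (normcD_le _ _))// subrKA. Qed.

Lemma normc_ge0 x : 0 <= normc x.
Proof. by case: x => a b /=; exact: sqrtr_ge0. Qed.

Lemma normc_eq0 x : (normc x == 0) = (x == 0).
Proof. by apply/eqP/eqP => [/eq0_normc//|->]; rewrite normc0. Qed.

Lemma normc_gt0 x : (0 < normc x) = (x != 0).
Proof. by rewrite lt0r normc_eq0 normc_ge0 andbT. Qed.

Lemma normcX x n : normc (x ^+ n) = normc x ^+ n.
Proof. by elim: n => [|n IH]; rewrite ?expr0 ?normc1// !exprS normcM IH. Qed.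

Lemma normc_real (a : R) : normc a%:C = `|a|.
Proof. by rewrite /= expr0n/= addr0 sqrtr_sqr. Qed.

Lemma normc_norm x : `|x| = (normc x)%:C.
Proof. by rewrite normc_def; case: x. Qed.

Lemma normc_sqr x : normc x ^+ 2 = complex.Re x ^+ 2 + complex.Im x ^+ 2.
Proof. by case: x => a b /=; rewrite sqr_sqrtr// addr_ge0 ?sqr_ge0. Qed.

Lemma normc_Re x : `|complex.Re x| <= normc x.
Proof.
by rewrite -ler_sqr ?nnegrE ?normc_ge0// normc_sqr real_normK ?num_real// lerDl sqr_ge0.
Qed.

Lemma normc_Im x : `|complex.Im x| <= normc x.
Proof.
by rewrite -ler_sqr ?nnegrE ?normc_ge0// normc_sqr real_normK ?num_real// lerDr sqr_ge0.
Qed.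

Lemma normc_le_ReIm x : normc x <= `|complex.Re x| + `|complex.Im x|.
Proof.
rewrite -ler_sqr ?nnegrE ?addr_ge0 ?normc_ge0// normc_sqr sqrrD !real_normK ?num_real//.
by rewrite lerD2r lerDl mulrn_wge0// mulr_ge0.
Qed.

Lemma normc_dist_ge x y : normc x - normc y <= normc (x - y).
Proof. by rewrite lerBlDr -{1}(subrK y x) normcD_le. Qed.

Lemma normc_sum I (r : seq I) (P : pred I) (F : I -> R[i]) :
  normc (\sum_(i <- r | P i) F i) <= \sum_(i <- r | P i) normc (F i).
Proof.
elim/big_rec2: _ => [|i a b _ h]; first by rewrite normc0.
by rewrite (le_trans (normcD_le _ _))// lerD2l.
Qed.

Lemma ReB x y : complex.Re (x - y) = complex.Re x - complex.Re y.
Proof. by case: x y => [? ?] [? ?]. Qed.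

Lemma ImB x y : complex.Im (x - y) = complex.Im x - complex.Im y.
Proof. by case: x y => [? ?] [? ?]. Qed.

End ComplexNorm.

Section ComplexDerivative.
Context {R : realType}.
Implicit Types (f g : R[i] -> R[i]) (z l : R[i]).

(** Differentiability with the error written as a product: [h = 0] is no exception, and all
    estimates are inequalities between reals instead of elements of [R[i]]. *)
Definition cdiff f z l := forall e : R, 0 < e -> exists2 d : R, 0 < d &
  forall h, normc h < d -> normc (f (z + h) - f z - l * h) <= e * normc h.

Lemma cdiff_cvgP f z l :
  (h^-1 *: ((f : R[i]^o -> R[i]^o) (h + z) - f z : R[i]^o)) @[h --> (0 : (R[i] :
    numFieldType))^'] --> (l : R[i]^o)
  <-> cdiff f z l.
Proof.
split=> [/cvgr_dist_le fl e e0|fl].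
  have e0' : (0 : R[i]) < e%:C by rewrite ltcE /= eqxx.
  have /= := fl _ e0'.
  case=> d /= d0 H.
  (* In the partial order of [R[i]] a positive element is real, so the radius can be read as a real
     number. *)
  have dE : d = (complex.Re d)%:C.
    by move: d0; rewrite ltcE /= => /andP[/eqP+ _]; case: d {H} => ? ? /= ->.
  have d0' : 0 < complex.Re d by move: d0; rewrite ltcE /= => /andP[_].
  exists (complex.Re d) => // h hd.
  have [->|h0] := eqVneq h 0.
    by rewrite addr0 subrr mulr0 subr0 normc0 mulr0.
  have /= := H h _ h0.
  rewrite sub0r normrN normc_norm dE ltcE/= eqxx/= => /(_ hd).
  rewrite normc_norm lecE /= eqxx/= => H1.
  have -> : f (z + h) - f z - l * h = - (l - h^-1 * (f (h + z) - f z)) * h.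
    by rewrite opprB mulrBl mulrAC mulVf // mul1r (addrC h).
  by rewrite normcM ler_wpM2r ?normc_ge0// normc_opp.
apply/cvgrPdist_le => e.
rewrite ltcE /= => /andP[/eqP ie re].
have [d d0 H] := fl _ re.
exists d%:C => /=; first by rewrite ltcE /= eqxx.
move=> h /=; rewrite sub0r normrN normc_norm ltcE/= eqxx/= => hd h0.
rewrite normc_norm lecE/= ie eqxx/=.
have nh : 0 < normc h by rewrite normc_gt0.
rewrite -(ler_pM2r nh) (le_trans _ (H _ hd))// -normcM -normc_opp.
rewrite le_eqVlt; apply/orP; left; apply/eqP; congr normc.
rewrite -mulNr opprB mulrBl [_ *: _]/(_ * _) mulrAC mulVf // mul1r.
by rewrite (addrC h).
Qed.

Lemma cdiff_cderiv f z l : cdiff f z l -> cderiv f z = l.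
Proof. by move=> /cdiff_cvgP; apply: cvg_lim. Qed.

Lemma cdiffP f z : derivable (f : R[i]^o -> R[i]^o) z 1 <-> cdiff f z (cderiv f z).
Proof.
have E : (fun h : R[i] => h^-1 *: (((f : R[i]^o -> R[i]^o) \o shift z) (h *: (1 : R[i]^o)) - f z
  : R[i]^o))
   = (fun h => h^-1 *: ((f : R[i]^o -> R[i]^o) (h + z) - f z : R[i]^o)).
  by apply/funext => h; rewrite /= [_ *: 1]mulr1.
rewrite -cdiff_cvgP /derivable E; split => [//|h].
by apply/cvg_ex; eexists; exact: h.
Qed.

Lemma cdiff_derivable f z l : cdiff f z l -> derivable (f : R[i]^o -> R[i]^o) z 1.
Proof. by move=> h; apply/cdiffP; rewrite (cdiff_cderiv h). Qed.

Lemma cdiff_continuous f z l : cdiff f z l ->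
  forall e : R, 0 < e -> exists2 d : R, 0 < d & forall h, normc h < d -> normc (f (z + h) - f z)
    < e.
Proof.
move=> fl e e0; have [d d0 H] := fl 1 ltr01.
pose K := 1 + normc l.
have K0 : 0 < K by rewrite ltr_wpDr ?normc_ge0.
exists (Num.min d (e / K)); first by rewrite lt_min d0 divr_gt0.
move=> h; rewrite lt_min => /andP[/H + hK].
rewrite mul1r => H1; rewrite ltr_pdivlMr// mulrC in hK.
apply: le_lt_trans hK.
rewrite -(subrK (l * h) (_ - _)) (le_trans (normcD_le _ _))// normcM /K mulrDl mul1r.
by rewrite lerD2r.
Qed.

Lemma cdiff_comp f g z l k : cdiff f z l -> cdiff g (f z) k -> cdiff (g \o f) z (k * l).
Proof.
move=> fl gk e e0.
pose K := normc l + 1.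
have K0 : 0 < K by rewrite ltr_wpDl ?normc_ge0.
(* The cap by 1 gives the Lipschitz bound [h4] with constant [K]; the second entry absorbs the
   factor [normc k]. *)
pose e1 := Num.min 1 (e / 2 / (normc k + 1)).
have k1 : 0 < normc k + 1 by rewrite ltr_wpDl ?normc_ge0.
have e10 : 0 < e1 by rewrite lt_min ltr01 !divr_gt0.
have [d1 d10 H1] := gk (e / 2 / K) ltac:(by rewrite !divr_gt0).
have [d2 d20 H2] := fl e1 e10.
have [d3 d30 H3] := cdiff_continuous fl d10.
exists (Num.min d2 d3); first by rewrite lt_min d20.
move=> h; rewrite lt_min => /andP[/H2 h2 /H3 h3] /=.
have := H1 _ h3; rewrite (addrC (f z)) subrK => h1.
have -> : g (f (z + h)) - g (f z) - k * l * h =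
  (g (f (z + h)) - g (f z) - k * (f (z + h) - f z)) + k * (f (z + h) - f z - l * h).
  by ring.
apply: (le_trans (normcD_le _ _)); rewrite normcM.
have h4 : normc (f (z + h) - f z) <= K * normc h.
  rewrite -(subrK (l * h) (_ - _)) (le_trans (normcD_le _ _))// normcM /K mulrDl mul1r addrC.
  rewrite lerD2l (le_trans h2)// ler_piMl ?normc_ge0//.
  by rewrite /e1 ge_min lexx.
rewrite [e]splitr mulrDl lerD//.
  apply: (le_trans h1).
  have ek : 0 <= e / 2 / K by rewrite ltW// !divr_gt0.
  by apply: (le_trans (ler_wpM2l ek h4)); rewrite mulrA divfK ?gt_eqF.
apply: (le_trans (ler_wpM2l (normc_ge0 _) h2)).
rewrite mulrA ler_wpM2r ?normc_ge0//.
apply: (@le_trans _ _ ((normc k + 1) * e1)); first by rewrite ler_wpM2r ?(ltW e10)// lerDl.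
rewrite mulrC -ler_pdivlMr//.
by rewrite /e1 ge_min lexx orbT.
Qed.

Lemma cdiff_ext f g z l : f =1 g -> cdiff f z l -> cdiff g z l.
Proof. by move=> /funext ->. Qed.

Lemma cdiff_affine a b z : cdiff (fun w => a * w + b) z a.
Proof.
move=> e e0; exists 1 => // h _.
have -> : a * (z + h) + b - (a * z + b) - a * h = 0 by ring.
by rewrite normc0 mulr_ge0 ?normc_ge0// ltW.
Qed.

Lemma cdiff_derive f z l : cdiff f z l -> is_derive (z : R[i]^o) 1 (f : R[i]^o -> R[i]^o) l.
Proof.
move=> h; split; first exact: cdiff_derivable h.
rewrite -(cdiff_cderiv h) /cderiv derive1E.
by [].
Qed.

Lemma derive_cdiff f z l : is_derive (z : R[i]^o) 1 (f : R[i]^o -> R[i]^o) l -> cdiff f z l.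
Proof.
move=> [/cdiffP h <-]; move: h.
by rewrite /cderiv derive1E.
Qed.

Lemma cdiffM f g z l k : cdiff f z l -> cdiff g z k ->
  cdiff (fun w => f w * g w) z (f z * k + g z * l).
Proof.
by move=> /cdiff_derive fl /cdiff_derive gk; apply: derive_cdiff; apply: is_deriveM.
Qed.

Lemma cdiffV f z l : f z != 0 -> cdiff f z l ->
  cdiff (fun w => (f w)^-1) z (- (f z) ^- 2 * l).
Proof.
move=> fz0 /cdiff_derive[fl <-]; apply: derive_cdiff.
by split; [exact: derivableV|exact: deriveV].
Qed.

End ComplexDerivative.

(** * Goursat's theorem on rectangles *)

Lemma itv_sub (R : realType) (a b a' b' x : R) :
  a <= a' -> b' <= b -> a' <= x <= b' -> a <= x <= b.
Proof.
by move=> h1 h2 /andP[h3 h4]; rewrite (le_trans h1 h3) (le_trans h4 h2).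
Qed.

Lemma itv_dist (R : realType) (a s x y : R) :
  a <= x <= a + s -> a <= y <= a + s -> `|x - y| <= s.
Proof.
by move=> /andP[h1 h2] /andP[h3 h4]; rewrite ler_norml; apply/andP; split; lra.
Qed.

Section Goursat.
Context {R : realType}.
Implicit Types (a b c d e r s t x y : R).

(** A mixed second difference. For a primitive in [x] of [P] it is the integral of [P] over the top
    side minus that over the bottom side; for a primitive in [y] of [Q], the right side minus the
    left side. *)
Definition rect_diff (m : R -> R -> R) a b c d := m b d - m b c - m a d + m a c.

Lemma rect_diff_split m a e b c f d : rect_diff m a b c d =
  rect_diff m a e c f + rect_diff m e b c f +
  (rect_diff m a e f d + rect_diff m e b f d).
Proof. by rewrite /rect_diff; ring. Qed.

(** Goursat's bisection. By additivity a nonzero value of modulus [E] passes to nested rectangles on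
    which the modulus is at least [E / 4 ^ n], whereas the hypothesis at their common point makes it
    small compared with the squared size, which is of order [4 ^ -n]. *)
Lemma rect_diff_eq0 (m : R -> R -> R) a s c t : 0 < s -> 0 < t ->
  (forall x y, a <= x <= a + s -> c <= y <= c + t ->
    forall e, 0 < e -> exists2 d, 0 < d & forall a' s' c' t',
      a <= a' -> a' + s' <= a + s -> c <= c' -> c' + t' <= c + t ->
      0 < s' < d -> 0 < t' < d -> a' <= x <= a' + s' -> c' <= y <= c' + t' ->
      `|rect_diff m a' (a' + s') c' (c' + t')| <= e * (s' + t') ^+ 2) ->
  rect_diff m a (a + s) c (c + t) = 0.
Proof.
move=> s0 t0 H; apply/eqP; rewrite -normr_le0; apply/negPn/negP; rewrite -ltNge => E0.
set E := `|_| in E0.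
pose S n := s / 2 ^+ n; pose T n := t / 2 ^+ n.
have Sp n : 0 < S n by rewrite divr_gt0 ?exprn_gt0.
have Tp n : 0 < T n by rewrite divr_gt0 ?exprn_gt0.
have SS n : S n = S n.+1 + S n.+1 by rewrite /S exprS; field; rewrite expf_neq0.
have TS n : T n = T n.+1 + T n.+1 by rewrite /T exprS; field; rewrite expf_neq0.
pose bad n u v := E / 4 ^+ n <= `|rect_diff m u (u + S n) v (v + T n)|.
have badS n u v : bad n u v ->
    exists i j : bool, bad n.+1 (u + i%:R * S n.+1) (v + j%:R * T n.+1).
  move=> bn; apply: contrapT => /forallNP nb.
  have nb' (i j : bool) : `|rect_diff m (u + i%:R * S n.+1) (u + i%:R * S n.+1 + S n.+1)
      (v + j%:R * T n.+1) (v + j%:R * T n.+1 + T n.+1)| < E / 4 ^+ n.+1.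
    by rewrite ltNge; apply/negP => h; apply: (nb i); exists j.
  have := nb' false false; have := nb' false true.
  have := nb' true false; have := nb' true true.
  rewrite !mul0r !mul1r !addr0 => h1 h2 h3 h4.
  have uS : u + S n = u + S n.+1 + S n.+1 by rewrite (SS n) addrA.
  have vT : v + T n = v + T n.+1 + T n.+1 by rewrite (TS n) addrA.
  move: bn; rewrite /bad uS vT (rect_diff_split m u (u + S n.+1) _ v (v + T n.+1)) => h5.
  have : E / 4 ^+ n < 4 * (E / 4 ^+ n.+1).
    apply: (le_lt_trans h5).
    move: h1 h2 h3 h4; set r := E / _.
    move: (rect_diff m u _ v _) (rect_diff m (u + _) _ v _) (rect_diff m u _ (v + _) _)
      (rect_diff m (u + _) _ (v + _) _) => X1 X2 X3 X4 h1 h2 h3 h4.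
    rewrite (le_lt_trans (ler_normD _ _))//.
    have := ler_normD X1 X2; have := ler_normD X3 X4; lra.
  have -> : 4 * (E / 4 ^+ n.+1) = E / 4 ^+ n by rewrite exprS; field; rewrite expf_neq0.
  by rewrite ltxx.
(* The last quarter is taken without a test: by [badS] it is bad as soon as the other three are
   not. *)
pose next n (w : R * R) : R * R :=
  let p i j := (w.1 + i%:R * S n.+1, w.2 + j%:R * T n.+1) in
  let ok i j := bad n.+1 (p i j).1 (p i j).2 in
  if ok true true then p true true else if ok true false then p true false else
  if ok false true then p false true else p false false.
pose fix w n : R * R := if n is n'.+1 then next n' (w n') else (a, c).
have wbad n : bad n (w n).1 (w n).2.
  elim: n => [|n IH] /=; first by rewrite /bad /S /T !expr0 !divr1.
  have [i [j]] := badS _ _ _ IH; rewrite /next.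
  case: ifPn => // n1; case: ifPn => // n2; case: ifPn => // n3.
  by case: i; case: j => //=; rewrite ?(negbTE n1) ?(negbTE n2) ?(negbTE n3).
have wnext n : exists i j : bool, w n.+1 = ((w n).1 + i%:R * S n.+1, (w n).2 + j%:R * T n.+1).
  rewrite /= /next; case: ifP => _; first by exists true, true.
  case: ifP => _; first by exists true, false.
  by case: ifP => _; [exists false, true|exists false, false].
have w1 n : (w n).1 <= (w n.+1).1 /\ (w n.+1).1 + S n.+1 <= (w n).1 + S n.
  have [i [j ->]] /= := wnext n; rewrite (SS n); have := Sp n.+1.
  by case: i; rewrite ?mul0r ?mul1r; split; lra.
have w2 n : (w n).2 <= (w n.+1).2 /\ (w n.+1).2 + T n.+1 <= (w n).2 + T n.
  have [i [j ->]] /= := wnext n; rewrite (TS n); have := Tp n.+1.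
  by case: j; rewrite ?mul0r ?mul1r; split; lra.
have nested (u r : R^nat) : (forall n, 0 < r n) ->
    (forall n, u n <= u n.+1 /\ u n.+1 + r n.+1 <= u n + r n) ->
    exists x, forall n, u n <= x <= u n + r n.
  move=> r0 un.
  have mono n k : u n <= u (n + k)%N /\ u (n + k)%N + r (n + k)%N <= u n + r n.
    elim: k => [|k [h1 h2]]; first by rewrite addn0.
    by rewrite addnS; have [h3 h4] := un (n + k)%N; split; [exact: le_trans h3|exact: le_trans
      h2].
  have ub n k : u k <= u n + r n.
    case: (leqP k n) => [/subnKC|/ltnW/subnKC] kn.
      have [h _] := mono k (n - k)%N; rewrite kn in h.
      by rewrite (le_trans h)// lerDl ltW.
    have [_ h] := mono n (k - n)%N; rewrite kn in h.
    by rewrite (le_trans _ h)// lerDl ltW.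
  exists (sup (range u)) => n; apply/andP; split.
    apply: ub_le_sup; last by exists n.
    by exists (u 0 + r 0) => _ [k _ <-].
  by apply: ge_sup; [exists (u 0), 0|move=> _ [k _ <-]].
have [x xP] := nested (fun n => (w n).1) S Sp w1.
have [y yP] := nested (fun n => (w n).2) T Tp w2.
have st0 : 0 < (s + t) ^+ 2 by rewrite exprn_gt0// addr_gt0.
(* Scaled so that at stage [n], where the two sides add up to [(s + t) / 2 ^ n], the resulting bound
   is half of [E / 4 ^ n]. *)
have [||| d d0 Hd] := H x y _ _ (E / 2 / (s + t) ^+ 2).
- by have := xP 0; rewrite /S expr0 divr1.
- by have := yP 0; rewrite /T expr0 divr1.
- by rewrite !divr_gt0.
have geo (r e : R) : 0 < e -> 0 < r -> exists N, forall n, (N <= n)%N -> r / 2 ^+ n < e.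
  move=> e0 r0.
  have := cvg_geometric r (z := 2^-1 : R); rewrite ger0_norm// invf_lt1 ?ltr1n// => /(_ isT).
  move/cvgrPdist_lt => /(_ _ e0) [N _ HN]; exists N => n /HN.
  rewrite /geometric/= sub0r normrN exprVn ger0_norm//.
  by rewrite ltW// divr_gt0// exprn_gt0.
have [N1 HN1] := geo s d d0 s0; have [N2 HN2] := geo t d d0 t0.
pose n := maxn N1 N2.
have inside k : [/\ a <= (w k).1, (w k).1 + S k <= a + s, c <= (w k).2 & (w k).2 + T k <= c + t].
  elim: k => [|k [h1 h2 h3 h4]]; first by rewrite /S /T !expr0 !divr1.
  have [h5 h6] := w1 k; have [h7 h8] := w2 k.
  by split; [exact: le_trans h5|exact: le_trans h2|exact: le_trans h7|exact: le_trans h4].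
have [i1 i2 i3 i4] := inside n.
have := Hd _ _ _ _ i1 i2 i3 i4 _ _ (xP n) (yP n).
rewrite Sp Tp (HN1 n) ?leq_maxl// (HN2 n) ?leq_maxr// => /(_ isT isT).
apply/negP; rewrite -ltNge; apply: lt_le_trans (wbad n).
have -> : E / 2 / (s + t) ^+ 2 * (S n + T n) ^+ 2 = E / 4 ^+ n / 2.
  have -> : (4 : R) ^+ n = 2 ^+ n * 2 ^+ n by rewrite -exprMn; congr (_ ^+ n); lra.
  by rewrite /S /T; field; rewrite expf_neq0//= gt_eqF// addr_gt0.
have : 0 < E / 4 ^+ n by rewrite divr_gt0// exprn_gt0.
lra.
Qed.

(* A closed form [P dx + Q dy] that is merely differentiable at every point has
   zero integral over the boundary of a rectangle; the boundary integral is
   expressed through primitives [p] of [P] in [x] and [q] of [Q] in [y]. *)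
Lemma goursat_rect (p q P Q : R -> R -> R) a b c d : a < b -> c < d ->
  (forall x y, a <= x <= b -> is_derive x 1 (p ^~ y) (P x y)) ->
  (forall x y, c <= y <= d -> is_derive y 1 (q x) (Q x y)) ->
  (forall x0 y0, exists A B C, forall e, 0 < e -> exists2 r, 0 < r &
    forall x y, `|x - x0| < r -> `|y - y0| < r ->
      `|P x y - P x0 y0 - A * (x - x0) - B * (y - y0)| <= e * (`|x - x0| + `|y - y0|) /\
      `|Q x y - Q x0 y0 - B * (x - x0) - C * (y - y0)| <= e * (`|x - x0| + `|y - y0|)) ->
  rect_diff p a b c d = rect_diff q a b c d.
Proof.
move=> ab cd pP qQ D.
apply/eqP; rewrite -subr_eq0; apply/eqP.
have -> : rect_diff p a b c d - rect_diff q a b c d =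
   rect_diff (fun x y => p x y - q x y) a b c d by rewrite /rect_diff; ring.
rewrite -[b](subrKC a) -[d](subrKC c); apply: rect_diff_eq0; rewrite ?subr_gt0//.
rewrite !subrKC => x0 y0 _ _ e e0.
have [A [B [C H]]] := D x0 y0.
have [r r0 Hr] := H (e / 4) ltac:(by rewrite divr_gt0).
exists r => // a' s c' t aa' sb cc' td /andP[s0 sr] /andP[t0 tr] /andP[x1 x2] /andP[y1 y2].
have near x y : a' <= x <= a' + s -> c' <= y <= c' + t ->
    [/\ `|x - x0| < r, `|y - y0| < r & `|x - x0| + `|y - y0| <= s + t].
  move=> h1 h2.
  have h5 : `|x - x0| <= s by apply: itv_dist h1 _; apply/andP.
  have h6 : `|y - y0| <= t by apply: itv_dist h2 _; apply/andP.
  by split; [exact: le_lt_trans sr|exact: le_lt_trans tr|exact: lerD].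
(* The mean value theorem turns the difference of two side integrals into one increment of [P], with
   linear part [B * t * s]. The increment of [Q] in [dq] has the linear part [B * s * t], which
   cancels it: the shared coefficient [B] expresses that the form is closed. *)
have dp : exists2 x, x \in `[a', a' + s]%R &
    rect_diff p a' (a' + s) c' (c' + t) = (P x (c' + t) - P x c') * s.
  have [|x||x xi E] := @MVT_segment R (fun x => p x (c' + t) - p x c')
    (fun x => P x (c' + t) - P x c') a' (a' + s).
  - by rewrite lerDl ltW.
  - rewrite in_itv/= => xi.
    by apply: is_deriveB; apply: pP; apply: (itv_sub aa' sb); move: xi => /andP[/ltW -> /ltW ->].
  - apply: derivable_within_continuous => x; rewrite in_itv/= => xi.
    by apply: derivableB; apply: ex_derive; apply: pP; apply: (itv_sub aa' sb).
  exists x => //; rewrite /rect_diff; move: E => /=; rewrite [X in _ * X]addrAC subrr add0r =>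
    <-; ring.
have dq : exists2 y, y \in `[c', c' + t]%R &
    rect_diff q a' (a' + s) c' (c' + t) = (Q (a' + s) y - Q a' y) * t.
  have [|x||x xi E] := @MVT_segment R (fun y => q (a' + s) y - q a' y)
    (fun y => Q (a' + s) y - Q a' y) c' (c' + t).
  - by rewrite lerDl ltW.
  - rewrite in_itv/= => xi.
    by apply: is_deriveB; apply: qQ; apply: (itv_sub cc' td); move: xi => /andP[/ltW -> /ltW ->].
  - apply: derivable_within_continuous => x; rewrite in_itv/= => xi.
    by apply: derivableB; apply: ex_derive; apply: qQ; apply: (itv_sub cc' td).
  exists x => //; rewrite /rect_diff; move: E => /=; rewrite [X in _ * X]addrAC subrr add0r =>
    <-; ring.
have -> : rect_diff (fun x y => p x y - q x y) a' (a' + s) c' (c' + t) =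
  rect_diff p a' (a' + s) c' (c' + t) - rect_diff q a' (a' + s) c' (c' + t).
  by rewrite /rect_diff; ring.
case: dp => x; rewrite in_itv/= => xi ->; case: dq => y; rewrite in_itv/= => yi ->.
have ca : a' <= a' <= a' + s by rewrite lexx lerDl ltW.
have cb : a' <= a' + s <= a' + s by rewrite lexx lerDl ltW.
have cc : c' <= c' <= c' + t by rewrite lexx lerDl ltW.
have ce : c' <= c' + t <= c' + t by rewrite lexx lerDl ltW.
have est x' y' : a' <= x' <= a' + s -> c' <= y' <= c' + t ->
   `|P x' y' - P x0 y0 - A * (x' - x0) - B * (y' - y0)| <= e / 4 * (s + t) /\
   `|Q x' y' - Q x0 y0 - B * (x' - x0) - C * (y' - y0)| <= e / 4 * (s + t).
  move=> h1 h2; have [h3 h4 h5] := near _ _ h1 h2; have [h6 h7] := Hr _ _ h3 h4.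
  by split; [apply: (le_trans h6)|apply: (le_trans h7)]; rewrite ler_wpM2l// divr_ge0// ltW.
have [P1 _] := est _ _ xi cc; have [P2 _] := est _ _ xi ce.
have [_ Q1] := est _ _ ca yi; have [_ Q2] := est _ _ cb yi.
have eE : e / 4 * (s + t) + e / 4 * (s + t) = e / 2 * (s + t) by field.
have PB : `|P x (c' + t) - P x c' - B * t| <= e / 2 * (s + t).
  have -> : P x (c' + t) - P x c' - B * t = (P x (c' + t) - P x0 y0 - A * (x - x0) - B * (c' + t
    - y0))
    - (P x c' - P x0 y0 - A * (x - x0) - B * (c' - y0)) by ring.
  by apply: (le_trans (ler_normB _ _)); rewrite -eE; exact: lerD P2 P1.
have QB : `|Q (a' + s) y - Q a' y - B * s| <= e / 2 * (s + t).
  have -> : Q (a' + s) y - Q a' y - B * s = (Q (a' + s) y - Q x0 y0 - B * (a' + s - x0) - C * (y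
    - y0))
    - (Q a' y - Q x0 y0 - B * (a' - x0) - C * (y - y0)) by ring.
  by apply: (le_trans (ler_normB _ _)); rewrite -eE; exact: lerD Q2 Q1.
have -> : (P x (c' + t) - P x c') * s - (Q (a' + s) y - Q a' y) * t =
  (P x (c' + t) - P x c' - B * t) * s - (Q (a' + s) y - Q a' y - B * s) * t by ring.
apply: (le_trans (ler_normB _ _)); rewrite !normrM (gtr0_norm s0) (gtr0_norm t0).
apply: (@le_trans _ _ (e / 2 * (s + t) * s + e / 2 * (s + t) * t)).
  by apply: lerD; rewrite ler_wpM2r// ltW.
by rewrite -mulrDr -mulrA -expr2 ler_wpM2r ?sqr_ge0// ler_pdivrMr// ler_peMr ?ler1n// ltW.
Qed.

End Goursat.

(** * Continuity of the derivative of an entire function *)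

Section CauchyMean.
Context {R : realType}.
Implicit Types (a b c d e r s t x y L : R) (w z : R[i]).

Lemma exists_primitive (f : R -> R) L : continuous f ->
  exists F : R -> R, forall x, L < x -> is_derive x 1 F (f x).
Proof.
move=> cf; exists (fun x => \int[lebesgue_measure]_(t in `[L, x]) f t) => x Lx.
have [||//|//|h1 h2] := @continuous_FTC1_closed R f L x (x + 1).
- by rewrite ltrDl.
- apply: continuous_compact_integrable; first exact: segment_compact.
  exact: continuous_subspaceT.
- exact: cf.
apply: DeriveDef; first exact: h1.
by rewrite -derive1E; exact: h2.
Qed.

Lemma is_derive_eps (f : R -> R) x l : is_derive x 1 f l ->
  forall e, 0 < e -> exists2 d, 0 < d & forall h : R, `|h| < d -> `|f (x + h) - f x - l * h| <=
    e * `|h|.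
Proof.
move=> [fd fl] e e0.
have : h^-1 *: (f (h + x) - f x) @[h --> 0^'] --> l.
  have E : (fun h : R => h^-1 *: ((f \o shift x) (h *: 1) - f x)) = (fun h => h^-1 *: (f (h + x)
    - f x)).
    by apply/funext => h; rewrite /= [_ *: 1]mulr1.
  by move: fd fl; rewrite /derivable /derive E => fd <-.
move/cvgrPdist_le => /(_ _ e0)[d /= d0 H]; exists d => // h hd.
have [->|h0] := eqVneq h 0; first by rewrite addr0 subrr mulr0 subr0 normr0 mulr0.
have := H h; rewrite /= sub0r normrN => /(_ hd h0).
rewrite -(ler_pM2r (x := `|h|)) ?normr_gt0// -normrM; apply: le_trans.
by rewrite -normrN mulrBl [_ *: _]/(_ * _) mulrAC mulVf// mul1r opprB (addrC h).
Qed.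

(** The mean value property over circles in logarithmic coordinates. Goursat is applied to
    [v dx + u dy], the imaginary part of [psi dw], on a rectangle one period high. The horizontal
    sides cancel, so the means of [u] over the vertical sides at [a], far to the left, and at [x0]
    agree; the first is close to [L], the second at most [e]. *)
Lemma cauchy_mean_Re (psi : R[i] -> R[i]) L t e x0 : 0 < t ->
  (forall w, exists l, cdiff psi w l) ->
  (forall x y, psi (x +i* (y + t)) = psi (x +i* y)) ->
  (forall r, 0 < r -> exists M, forall x y, x < M -> `|complex.Re (psi (x +i* y)) - L| <= r) ->
  (forall y, complex.Re (psi (x0 +i* y)) <= e) -> L <= e.
Proof.
move=> t0 psiD psiT psiL psie.
apply/ler_addgt0Pr => r r0.
have [M HM] := psiL _ r0.
pose a := Num.min M x0 - 1.
have aM : a < M by rewrite /a ltrBlDr (@le_lt_trans _ _ M)// ?ltrDl// ge_min lexx.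
have ax0 : a < x0 by rewrite /a ltrBlDr (@le_lt_trans _ _ x0)// ?ltrDl// ge_min lexx orbT.
pose u x y := complex.Re (psi (x +i* y)).
pose v x y := complex.Im (psi (x +i* y)).
have cpsi x y d : 0 < d -> exists2 s, 0 < s & forall x' y', `|x - x'| + `|y - y'| < s ->
    normc (psi (x +i* y) - psi (x' +i* y')) < d.
  move=> d0; have [l hl] := psiD (x +i* y); have [s s0 hs] := cdiff_continuous hl d0.
  exists s => // x' y' h; have := hs ((x' - x) +i* (y' - y)).
  have -> : (x +i* y) + ((x' - x) +i* (y' - y)) = x' +i* y'.
    by apply/eqP; rewrite eq_complex /= !subrKC !eqxx.
  rewrite normc_distC; apply; apply: le_lt_trans (normc_le_ReIm _) _.
  by rewrite /= (distrC x') (distrC y').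
have cu x : continuous (u x).
  move=> y; apply/cvgrPdist_lt => d d0; have [s s0 hs] := cpsi x y _ d0.
  exists s => //= y' yy'; rewrite -ReB; apply: le_lt_trans (normc_Re _) _.
  by apply: hs; rewrite subrr normr0 add0r.
have cv y : continuous (v ^~ y).
  move=> x; apply/cvgrPdist_lt => d d0; have [s s0 hs] := cpsi x y _ d0.
  exists s => //= y' yy'; rewrite -ImB; apply: le_lt_trans (normc_Im _) _.
  by apply: hs; rewrite subrr normr0 addr0.
have /choice[q qP] : forall x, exists q : R -> R, forall y, -1 < y -> is_derive y 1 q (u x y).
  by move=> x; exact: exists_primitive.
have /choice[p' pP'] : forall y, exists p : R -> R, forall x, a - 1 < x -> is_derive x 1 p (v x
  y).
  by move=> y; exact: exists_primitive (cv y).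
pose p x y := p' y x.
have E : rect_diff p a x0 0 t = rect_diff q a x0 0 t.
  apply: (@goursat_rect R p q v u) => //.
  - by move=> x y /andP[h1 _]; apply: pP'; rewrite ltrBlDr (le_lt_trans h1)// ltrDl.
  - by move=> x y /andP[h1 _]; apply: qP; rewrite (lt_le_trans _ h1)// ltrN10.
  move=> x1 y1; have [l hl] := psiD (x1 +i* y1).
  (* Cauchy-Riemann: the [y]-derivative of [v] and the [x]-derivative of [u] are both
     [complex.Re l]. *)
  exists (complex.Im l), (complex.Re l), (- complex.Im l) => d d0.
  have [s s0 hs] := hl _ d0.
  exists (s / 2); first by rewrite divr_gt0.
  move=> x y xs ys.
  pose h := (x - x1) +i* (y - y1).
  have nh : normc h <= `|x - x1| + `|y - y1| by exact: normc_le_ReIm.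
  have hh : psi (x1 +i* y1 + h) = psi (x +i* y).
    by congr psi; apply/eqP; rewrite eq_complex /= !subrKC !eqxx.
  have := hs h; rewrite hh => /(_ (le_lt_trans nh _)).
  rewrite [s]splitr => /(_ (ltrD xs ys)) H.
  have {}H := le_trans H (ler_wpM2l (ltW d0) nh).
  split; apply: le_trans H.
  - apply: le_trans (normc_Im _); rewrite le_eqVlt; apply/orP; left; apply/eqP; congr (`| _ |).
    by rewrite /v; case: l {hl hs} => l1 l2 /=; rewrite !ImB /=; ring.
  - apply: le_trans (normc_Re _); rewrite le_eqVlt; apply/orP; left; apply/eqP; congr (`| _ |).
    by rewrite /u; case: l {hl hs} => l1 l2 /=; rewrite !ReB /=; ring.
have Ep : rect_diff p a x0 0 t = 0.
  have [x|x|x xi] := @MVT R (fun x => p x t - p x 0) (fun x => v x t - v x 0) a x0 ax0.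
  - rewrite in_itv/= => /andP[h1 _].
    by apply: is_deriveB; apply: pP'; rewrite ltrBlDr (lt_trans h1)// ltrDl.
  - move: x; apply: derivable_within_continuous => x; rewrite in_itv/= => /andP[h1 _].
    by apply: derivableB; apply: ex_derive; apply: pP'; rewrite ltrBlDr (le_lt_trans h1)// ltrDl.
  rewrite /v -[in X in (X - _) * _](add0r t) psiT subrr mul0r /= => H.
  transitivity (p x0 t - p x0 0 - (p a t - p a 0)); [by rewrite /rect_diff; ring|exact: H].
have mean x : exists y, q x t - q x 0 = u x y * t.
  have [y|y|y _ H] := @MVT R (q x) (u x) 0 t t0.
  - by rewrite in_itv/= => /andP[h1 _]; apply: qP; rewrite (lt_trans _ h1)// ltrN10.
  - move: y; apply: derivable_within_continuous => y; rewrite in_itv/= => /andP[h1 _].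
    by apply: ex_derive; apply: qP; rewrite (lt_le_trans _ h1)// ltrN10.
  by exists y; rewrite H subr0.
have [y1 m1] := mean a; have [y2 m2] := mean x0.
have : u a y1 * t = u x0 y2 * t.
  by rewrite -m1 -m2; move: E; rewrite Ep /rect_diff; lra.
move/(mulIf (lt0r_neq0 t0)) => u12.
have := HM a y1 aM; rewrite -/(u a y1) u12 ler_norml => /andP[h2 _].
by have := psie y2; rewrite -/(u x0 y2); lra.
Qed.

(** Multiplying [psi] by the conjugate of [L] reduces the modulus to a real part, because
    [L^* L = |L|^2]. *)
Lemma cauchy_mean (psi : R[i] -> R[i]) (L : R[i]) t e x0 : 0 < t ->
  (forall w, exists l, cdiff psi w l) ->
  (forall x y, psi (x +i* (y + t)) = psi (x +i* y)) ->
  (forall r, 0 < r -> exists M, forall x y, x < M -> normc (psi (x +i* y) - L) <= r) ->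
  (forall y, normc (psi (x0 +i* y)) <= e) -> normc L <= e.
Proof.
move=> t0 psiD psiT psiL psie.
have e0 : 0 <= e by apply: le_trans (psie 0); exact: normc_ge0.
have [->|L0] := eqVneq L 0; first by rewrite normc0.
have nL : 0 < normc L by rewrite normc_gt0.
have nJ : normc (L^*)%C = normc L by case: {L0 nL psiL} L => a b /=; rewrite sqrrN.
have ReLL : complex.Re ((L^*)%C * L) = normc L ^+ 2.
  by rewrite normc_sqr; case: {L0 nL psiL nJ} L => a b /=; ring.
rewrite -(ler_pM2l nL) -expr2 -ReLL.
apply: (@cauchy_mean_Re (fun w => (L^*)%C * psi w) _ t _ x0 t0).
- move=> w; have [l hl] := psiD w; exists ((L^*)%C * l).
  apply: (cdiff_ext _ (cdiff_comp hl (cdiff_affine (L^*)%C 0 _))) => z /=.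
  by rewrite addr0.
- by move=> x y; rewrite psiT.
- move=> r r0; have [M HM] := psiL (r / normc L) (divr_gt0 r0 nL).
  exists M => x y xM; rewrite -ReB -mulrBr (le_trans (normc_Re _))// normcM nJ.
  by rewrite mulrC -ler_pdivlMr//; exact: HM.
- move=> y; rewrite (le_trans (ler_norm _))// (le_trans (normc_Re _))// normcM nJ.
  by rewrite ler_wpM2l// ltW.
Qed.

Definition cexp w : R[i] :=
  (expR (complex.Re w) * cos (complex.Im w)) +i* (expR (complex.Re w) * sin (complex.Im w)).

Lemma cexp0 : cexp 0 = 1.
Proof. by rewrite /cexp /= expR0 cos0 sin0 mul1r mulr0. Qed.

Lemma cexpD w z : cexp (w + z) = cexp w * cexp z.
Proof.
case: w z => [a b] [c d]; rewrite /cexp /= expRD cosD sinD.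
by apply/eqP; rewrite eq_complex /=; apply/andP; split; apply/eqP; ring.
Qed.

Lemma normc_cexp w : normc (cexp w) = expR (complex.Re w).
Proof.
by rewrite /cexp /= !exprMn -mulrDr cos2Dsin2 mulr1 sqrtr_sqr gtr0_norm ?expR_gt0.
Qed.

Lemma cexp_neq0 w : cexp w != 0.
Proof. by rewrite -normc_gt0 normc_cexp expR_gt0. Qed.

Lemma cdiff_cexp0 : cdiff cexp 0 1.
Proof.
(* The real and the imaginary part of the error are each at most [3 * e' * N], whence the 6. *)
move=> e e0; pose e' := Num.min 1 (e / 6).
have e'0 : 0 < e' by rewrite lt_min ltr01 divr_gt0.
have e'1 : e' <= 1 by rewrite ge_min lexx.
have e'6 : e' <= e / 6 by rewrite ge_min lexx orbT.
have [d1 d10 H1] := is_derive_eps (is_derive_expR (0 : R)) e'0.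
have [d2 d20 H2] := is_derive_eps (is_derive_cos (0 : R)) e'0.
have [d3 d30 H3] := is_derive_eps (is_derive_sin (0 : R)) e'0.
have m0 : 0 < Num.min (Num.min d1 d2) (Num.min d3 (e' / 2)) by rewrite !lt_min d10 d20 d30
  divr_gt0.
exists (Num.min (Num.min d1 d2) (Num.min d3 (e' / 2))) => // -[x y].
rewrite add0r cexp0 mul1r.
have xN := normc_Re (x +i* y); have yN := normc_Im (x +i* y).
set N := normc (x +i* y) in xN yN * => h.
apply: le_trans (normc_le_ReIm _) _.
rewrite !ReB !ImB /= subr0; rewrite /= in xN yN.
have := le_lt_trans (normc_Re (x +i* y)) h; have := le_lt_trans (normc_Im (x +i* y)) h.
rewrite /= !lt_min => /andP[/andP[_ y2] /andP[y3 _]] /andP[/andP[x1 _] /andP[_ x4]].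
have := H1 _ x1; have := H2 _ y2; have := H3 _ y3.
rewrite !add0r expR0 sin0 cos0 subr0 oppr0 mul0r subr0 !mul1r => h3 h2 h1.
set ex := expR x - 1 - x in h1.
have k1 : `|expR x - 1| <= e'.
  rewrite (_ : expR x - 1 = ex + x); last by rewrite /ex; ring.
  rewrite (le_trans (ler_normD _ _))//.
  have : e' * `|x| <= `|x| by rewrite ler_piMl.
  move: (normr_ge0 x) h1 x4; move: `|ex| `|x| => X Y; lra.
have k2 : `|expR x| <= 2.
  rewrite (_ : expR x = (expR x - 1) + 1); last by ring.
  by rewrite (le_trans (ler_normD _ _))// normr1; lra.
have k3 : `|sin y| <= 2 * `|y|.
  rewrite (_ : sin y = (sin y - y) + y); last by ring.
  rewrite (le_trans (ler_normD _ _))//.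
  have : e' * `|y| <= `|y| by rewrite ler_piMl.
  lra.
have a1 : `|expR x * cos y - 1 - x| <= 3 * e' * N.
  rewrite (_ : _ - x = ex + expR x * (cos y - 1)); last by rewrite /ex; ring.
  rewrite (le_trans (ler_normD _ _))// normrM.
  have m1 : `|expR x| * `|cos y - 1| <= 2 * (e' * N).
    by apply: ler_pM => //; apply: (le_trans h2); rewrite ler_wpM2l// ltW.
  have m2 : e' * `|x| <= e' * N by rewrite ler_wpM2l// ltW.
  lra.
have a2 : `|expR x * sin y - y| <= 3 * e' * N.
  rewrite (_ : _ - y = (expR x - 1) * sin y + (sin y - y)); last by ring.
  rewrite (le_trans (ler_normD _ _))// normrM.
  have m1 : `|expR x - 1| * `|sin y| <= e' * (2 * N).
    by apply: ler_pM => //; apply: (le_trans k3); rewrite ler_wpM2l.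
  have m2 : e' * `|y| <= e' * N by rewrite ler_wpM2l// ltW.
  lra.
have N0 : 0 <= N by exact: normc_ge0.
apply: (le_trans (lerD a1 a2)).
have : e' * N <= e / 6 * N by rewrite ler_wpM2r.
lra.
Qed.

Lemma cdiff_cexp w : cdiff cexp w (cexp w).
Proof.
move=> e e0; have E0 : 0 < normc (cexp w) by rewrite normc_cexp expR_gt0.
have [d d0 H] := cdiff_cexp0 (divr_gt0 e0 E0).
exists d => // h /H; rewrite add0r mul1r => H1.
have -> : cexp (w + h) - cexp w - cexp w * h = cexp w * (cexp h - cexp 0 - h).
  by rewrite cexpD cexp0; ring.
by rewrite normcM mulrC -ler_pdivlMr// mulrAC.
Qed.

Lemma entire_cdiff (phi : R[i] -> R[i]) z : entire phi -> cdiff phi z (cderiv phi z).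
Proof. by move=> /(_ z I) /cdiffP. Qed.

(* [phi'(z) - phi'(c)] is the mean over a circle around [z] of
   [(phi(z + E) - phi(z)) / E - phi'(c)], which is small as soon as [z] lies
   within the radius of the circle of [c], by differentiability at [c] alone. *)
Lemma entire_cderiv_continuous (phi : R[i] -> R[i]) (c : R[i]) e : entire phi -> 0 < e ->
  exists2 r, 0 < r & forall z, normc (z - c) < r -> normc (cderiv phi z - cderiv phi c) <= e.
Proof.
move=> phiE e0.
(* On the circle of radius [r = d / 2] around [z], the points [z + E] and [z] lie at distances less
   than [2 r] and [r] from [c]; the two errors add up to at most [e / 3 * 3 r]. *)
have [d d0 H] := entire_cdiff c phiE (divr_gt0 e0 (ltr0n R 3)).
exists (d / 2); first by rewrite divr_gt0.
move=> z zc; set r := d / 2 in zc *.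
have r0 : 0 < r by rewrite divr_gt0.
pose psi w := (phi (z + cexp w) - phi z) * (cexp w)^-1 - cderiv phi c.
apply: (@cauchy_mean psi _ (pi *+ 2) _ (ln r)).
- by rewrite mulrn_wgt0// pi_gt0.
- move=> w.
  have h1 : cdiff (fun w => phi (z + cexp w) - phi z) w (1 * (cderiv phi (z + cexp w) * (1 *
    cexp w))).
    apply: (@cdiff_ext _ ((fun u => 1 * u + (- phi z)) \o (phi \o ((fun u => 1 * u + z) \o
      cexp)))).
      by move=> u /=; rewrite !mul1r (addrC z).
    apply: cdiff_comp; last exact: cdiff_affine.
    apply: cdiff_comp; first by apply: cdiff_comp; [exact: cdiff_cexp|exact: cdiff_affine].
    by rewrite /= mul1r addrC; exact: entire_cdiff.
  have := cdiff_comp (cdiffM h1 (cdiffV (cexp_neq0 w) (cdiff_cexp w))) (cdiff_affine 1 (- cderiv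
    phi c) _).
  set l := (X in cdiff _ _ X) => hl; exists l; apply: cdiff_ext hl => u /=.
  by rewrite mul1r.
- by move=> x y; rewrite /psi /cexp /= cosD2pi sinD2pi.
- move=> q q0.
  have [s s0 Hs] := entire_cdiff z phiE q0.
  exists (ln s) => x y xs.
  have nE : normc (cexp (x +i* y)) = expR x by rewrite normc_cexp.
  have := Hs (cexp (x +i* y)); rewrite nE -{1}(lnK s0) ltr_expR => /(_ xs) h.
  rewrite /psi opprB addrA subrK -(ler_pM2r (expR_gt0 x)) -{1}nE -normcM mulrBl divfK
    ?cexp_neq0//.
- move=> y; set E := cexp (ln r +i* y).
  have nE : normc E = r by rewrite normc_cexp lnK.
  rewrite /psi -(ler_pM2r r0) -[X in _ * X <= _]nE -normcM mulrBl divfK ?cexp_neq0//.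
  have dz : normc (z - c) < d by rewrite (lt_trans zc)// /r; lra.
  have dE : normc (z - c + E) < r + r.
    by rewrite (le_lt_trans (normcD_le _ _))// nE ltrD2r.
  have := H _ dz; have := H (z - c + E); rewrite {1}(_ : d = r + r); last by rewrite /r; lra.
  move=> /(_ dE); rewrite addrA !(addrC c) !subrK => h1 h2.
  rewrite (_ : _ - _ = (phi (z + E) - phi c - cderiv phi c * (z - c + E)) -
    (phi z - phi c - cderiv phi c * (z - c))); last by ring.
  apply: (le_trans (normcB_le _ _)); apply: (le_trans (lerD h1 h2)).
  rewrite -mulrDr mulrAC -mulrA ler_wpM2l// ?ltW//.
  by lra.
Qed.

End CauchyMean.

(** * Lacunary series *)

Section Auxiliary.
Context {R : realType}.
Implicit Types (r v x : R).

Lemma geometric_sum_le v n : 0 <= v -> v < 1 -> \sum_(k < n) v ^+ k <= (1 - v)^-1.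
Proof.
move=> v0 v1; have v10 : 0 < 1 - v by rewrite subr_gt0.
rewrite -(ler_pM2l v10) divff ?gt_eqF//.
have -> : (1 - v) * \sum_(k < n) v ^+ k = 1 - v ^+ n.
  by have := subrXX 1 v n; rewrite expr1n => ->; congr (_ * _); apply: eq_bigr => i _; rewrite
    expr1n mul1r.
by rewrite lerBlDr lerDl exprn_ge0.
Qed.

(** Combines [r <= exp (- (1 - r))] with [x / m <= exp (x / m)]. It is used with [m = 2] for the
    tail of the series and [m = 3] for its differentiation. *)
Lemma expr_decay r n m : 0 <= r -> r < 1 -> (0 < m)%N ->
  r ^+ n * (n%:R * (1 - r)) ^+ m <= m%:R ^+ m.
Proof.
move=> r0 r1 m0; have m0' : 0 < m%:R :> R by rewrite ltr0n.
set x := n%:R * (1 - r).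
have x0 : 0 <= x by rewrite mulr_ge0// subr_ge0 ltW.
have h1 : r ^+ n <= expR (- x).
  rewrite /x -mulrN expRM_natl lerXn2r ?nnegrE ?expR_ge0//.
  by have := expR_ge1Dx (- (1 - r)); rewrite opprB addrC subrK.
move: x x0 h1 => x x0 h1.
have h2 : x ^+ m <= m%:R ^+ m * expR x.
  have -> : expR x = expR (x / m%:R) ^+ m by rewrite -expRM_natl mulrCA mulfV ?mulr1 ?gt_eqF.
  rewrite -exprMn; apply: lerXn2r; rewrite ?nnegrE ?mulr_ge0 ?expR_ge0//.
  rewrite mulrC -ler_pdivrMr//.
  by apply: le_trans (expR_ge1Dx _); rewrite lerDr.
have := ler_pM (exprn_ge0 n r0) (exprn_ge0 m x0) h1 h2.
by rewrite mulrCA -expRD addNr expR0 mulr1.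
Qed.

Lemma bernoulli r n : 0 <= r -> r <= 1 -> 1 - n%:R * (1 - r) <= r ^+ n.
Proof.
move=> r0 r1; elim: n => [|n IH]; first by rewrite mul0r subr0 expr0.
rewrite exprS; apply: le_trans (ler_wpM2l r0 IH).
have : 0 <= n%:R * (1 - r) ^+ 2 by rewrite mulr_ge0 ?sqr_ge0.
rewrite -natr1; move: (n%:R : R) => X; nra.
Qed.

Lemma complex_series_ex (u : nat -> R[i]) M v : 0 <= v -> v < 1 ->
  (forall k, normc (u k) <= M * v ^+ k) ->
  exists S : R[i], forall e, 0 < e -> exists K0, forall K, (K0 <= K)%N ->
    normc (\sum_(k < K) u k - S) <= e.
Proof.
move=> v0 v1 uM.
have cv (t : nat -> R) : (forall k, `|t k| <= normc (u k)) -> cvgn (series t).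
  move=> tu; apply: normed_cvg.
  apply: (@series_le_cvg _ _ (geometric M v)) => [n|n|n|].
  - exact: normr_ge0.
  - by rewrite /geometric /= (le_trans _ (uM n))// normc_ge0.
  - by rewrite /geometric /= (le_trans (tu n)).
  - by apply: is_cvg_geometric_series; rewrite ger0_norm.
have cR := cv (fun k => complex.Re (u k)) (fun k => normc_Re _).
have cI := cv (fun k => complex.Im (u k)) (fun k => normc_Im _).
set SR := fun k => complex.Re (u k) in cR.
set SI := fun k => complex.Im (u k) in cI.
exists (limn (series SR) +i* limn (series SI)) => e e0.
have e20 : 0 < e / 2 by rewrite divr_gt0.
move/cvgrPdist_lt: cR => /(_ _ e20)[K1 _ H1].
move/cvgrPdist_lt: cI => /(_ _ e20)[K2 _ H2].
exists (maxn K1 K2) => K; rewrite geq_max => /andP[/H1 /= h1 /H2 /= h2].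
apply: le_trans (normc_le_ReIm _) _.
have -> : \sum_(k < K) u k = series SR K +i* series SI K.
  rewrite /series /= !big_mkord; elim: K {h1 h2} => [|K IH]; first by rewrite !big_ord0.
  by rewrite !big_ord_recr /= IH /SR /SI; case: (u K).
by rewrite ReB ImB /= distrC (distrC (series SI K)); lra.
Qed.

(** With [h = w - z], the remainder satisfies [E_(n+1) = (n + 1) z ^ n h ^ 2 + w E_n], and
    [n ^ 2 + n + 1 <= (n + 1) ^ 2]. The factor [rho] on the left avoids the exponent [n - 1]. The
    bound is explicit in [n], so it can be summed to differentiate the series term by term. *)
Lemma normc_taylor1 (w z : R[i]) rho n : normc w <= rho -> normc z <= rho ->
  rho * normc (w ^+ n.+1 - z ^+ n.+1 - n.+1%:R * z ^+ n * (w - z)) <=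
  n%:R ^+ 2 * rho ^+ n * normc (w - z) ^+ 2.
Proof.
move=> wr zr; have r0 : 0 <= rho := le_trans (normc_ge0 _) wr.
elim: n => [|n IH].
  by rewrite !expr1 expr0 mulr1 mul1r subrr normc0 mulr0 expr0n /= !mul0r.
set E := _ - n.+1%:R * _ * _ in IH.
have -> : w ^+ n.+2 - z ^+ n.+2 - n.+2%:R * z ^+ n.+1 * (w - z) =
  n.+1%:R * z ^+ n * (w - z) ^+ 2 + w * E.
  by rewrite /E !exprS -!natr1; ring.
apply: (le_trans (ler_wpM2l r0 (normcD_le _ _))).
rewrite !normcM !normcX mulrDr.
have nn (k : nat) : normc (k%:R : R[i]) = k%:R.
  by rewrite -(rmorph_nat (real_complex R)) normc_real ger0_norm.
rewrite nn; set h := normc (w - z) in IH *; set X := n%:R ^+ 2 in IH.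
have a1 : rho * (n.+1%:R * normc z ^+ n * h ^+ 2) <= n.+1%:R * rho ^+ n.+1 * h ^+ 2.
  have h1 : normc z ^+ n <= rho ^+ n by rewrite lerXn2r ?nnegrE ?normc_ge0.
  have -> : n.+1%:R * rho ^+ n.+1 * h ^+ 2 = rho * (n.+1%:R * rho ^+ n * h ^+ 2) by rewrite
    exprS; ring.
  by rewrite ler_wpM2l// ler_wpM2r ?sqr_ge0// ler_wpM2l.
have a2 : rho * (normc w * normc E) <= X * rho ^+ n.+1 * h ^+ 2.
  have -> : X * rho ^+ n.+1 * h ^+ 2 = rho * (X * rho ^+ n * h ^+ 2) by rewrite exprS; ring.
  by rewrite ler_wpM2l// (le_trans _ IH)// ler_wpM2r ?normc_ge0.
apply: (le_trans (lerD a1 a2)); rewrite -!mulrDl ler_wpM2r ?sqr_ge0// ler_wpM2r ?exprn_ge0//.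
rewrite /X -natr1; have : (0 : R) <= n%:R by []; move: (n%:R : R) => Y; nra.
Qed.

End Auxiliary.

Section LacunarySeries.
Context {R : realType}.
Variables (N : nat) (c : nat -> R) (v : R).
Hypotheses (N513 : (513 <= N)%N) (c0 : forall k, 0 < c k)
  (c_lo : forall k, 9 * c k <= c k.+1) (c_hi : forall k, c k.+1 <= N%:R * c k)
  (v0 : 0 <= v) (v1 : v < 1) (c_v : forall k, c k <= v ^+ k * N%:R ^+ k).

Let N0 : 0 < N%:R :> R. Proof. by rewrite ltr0n (leq_trans _ N513). Qed.
Let NX k : 0 < N%:R ^+ k :> R. Proof. by rewrite exprn_gt0. Qed.

Let c_hiX k i : c (k + i)%N <= N%:R ^+ i * c k.
Proof.
elim: i => [|i IH]; first by rewrite addn0 mul1r.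
by rewrite addnS exprS -mulrA (le_trans (c_hi _))// ler_wpM2l// ltW.
Qed.

Let sum_lo k : \sum_(j < k) c j <= c k / 8.
Proof.
elim: k => [|k IH]; first by rewrite big_ord0 divr_ge0// ltW.
by rewrite big_ord_recr /=; have := c_lo k; lra.
Qed.

Let invN : 513 * (N%:R : R)^-1 <= 1.
Proof. by rewrite ler_pdivrMr ?N0 ?mul1r ?ler_nat. Qed.

Let iN0 : 0 <= (N%:R : R)^-1. Proof. by rewrite invr_ge0 ltW. Qed.

Let iN1 : (N%:R : R)^-1 < 1.
Proof. by rewrite invf_lt1// ltr1n (leq_trans _ N513). Qed.

(** The terms before the [k]-th sum to at most [c k / 8] because [c] grows at least ninefold. A term
    [i] places later gains at most [N ^ i] in its coefficient, while [expr_decay] bounds its power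
    of [normc z] by [64 / N ^ (2 i)]. The tail is thus at most [64 * c k / (N - 1)], which is
    [c k / 8] or less exactly from [N = 513] on. *)
Let lacunary_partial (z : R[i]) k K : normc z < 1 -> (4 * N%:R ^+ k)^-1 <= 1 - normc z ->
  (k < K)%N -> normc (\sum_(j < K) (c j)%:C * z ^+ (N ^ j) - (c k)%:C * z ^+ (N ^ k)) <= c k / 4.
Proof.
move=> z1 zk kK; have z0 := normc_ge0 z; set r := normc z in z1 zk z0.
have term j : normc ((c j)%:C * z ^+ (N ^ j)) = c j * r ^+ (N ^ j).
  by rewrite normcM normc_real normcX gtr0_norm.
rewrite -(subnKC kK) big_split_ord /= big_ord_recr /= addrAC addrK.
apply: (le_trans (normcD_le _ _)).
have -> : c k / 4 = c k / 8 + c k / 8 by lra.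
apply: lerD.
  apply: (le_trans (normc_sum _ _ _)); apply: le_trans (sum_lo k).
  by apply: ler_sum => i _; rewrite term ler_piMr ?exprn_ile1// ltW.
apply: (le_trans (normc_sum _ _ _)).
apply: (@le_trans _ _ (\sum_(i < K - k.+1) (64 * c k / N%:R) * N%:R^-1 ^+ i)).
  apply: ler_sum => i _; rewrite term addSnnS.
  have Mi := c_hiX k i.+1.
  have n0 : 0 < N%:R ^+ i.+1 :> R by [].
  have := expr_decay (N ^ (k + i.+1)) z0 z1 (m := 2) isT.
  rewrite natrX exprD => h.
  have h2 : N%:R ^+ i.+1 / 4 <= N%:R ^+ k * N%:R ^+ i.+1 * (1 - r).
    rewrite mulrAC [leLHS]mulrC ler_wpM2r ?(ltW n0)//.
    by rewrite -ler_pdivrMl ?NX// mulrC -invfM.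
  have h3 : r ^+ (N ^ (k + i.+1)) * (N%:R ^+ i.+1 / 4) ^+ 2 <= 4.
    apply: le_trans (_ : _ <= (2%:R : R) ^+ 2) _; last by rewrite expr2; lra.
    apply: le_trans h; rewrite ler_wpM2l ?exprn_ge0// lerXn2r ?nnegrE//.
    by apply: le_trans h2; rewrite divr_ge0// ltW.
  rewrite -[in leRHS]mulrA -exprS exprVn.
  apply: (le_trans (ler_wpM2r _ Mi)); first by rewrite exprn_ge0.
  rewrite ler_pdivlMr// ; move: h3 n0; set X := N%:R ^+ i.+1; set Y := r ^+ _ => h3 n0.
    have -> : X * c k * Y * X = 16 * c k * (Y * (X / 4) ^+ 2) by field.
  have -> : 64 * c k = 16 * c k * 4 by ring.
  by rewrite ler_wpM2l// mulr_ge0// ltW.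
rewrite -mulr_sumr.
apply: (le_trans (ler_wpM2l _ (geometric_sum_le _ iN0 iN1))).
  by rewrite !mulr_ge0// ltW.
have i10 : 0 < 1 - (N%:R : R)^-1 by rewrite subr_gt0.
rewrite ler_pdivrMr//; have := ler_wpM2l (ltW (c0 k)) invN.
by move: (N%:R^-1 : R) (c k) => i x; lra.
Qed.

(** [f] is the termwise primitive of [g], and [c_v] bounds its coefficients by [v ^ k]. The last
    clause, a limit of [lacunary_partial], holds all the way to the centre of the disc and not only
    on one annulus; it therefore serves the upper bound for [Q_s] as well as the lower bound for
    [D^p_alpha]. *)
Lemma lacunary_ex : exists f g : R[i] -> R[i],
  [/\ forall z, normc z < 1 -> cdiff f z (g z),
      forall z, normc z < 1 -> normc (f z) <= (1 - v)^-1 &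
      forall z k, normc z < 1 -> (4 * N%:R ^+ k)^-1 <= 1 - normc z ->
        normc (g z - (c k)%:C * z ^+ (N ^ k)) <= c k / 4].
Proof.
pose n k := (N ^ k)%N.
have nR k : (n k)%:R = N%:R ^+ k :> R by rewrite natrX.
pose a k := c k / (n k).+1%:R.
have a0 k : 0 < a k by rewrite divr_gt0.
have an k : a k * (n k).+1%:R = c k by rewrite divfK.
have av k : a k <= v ^+ k.
  rewrite ler_pdivrMr// (le_trans (c_v k))// ler_wpM2l ?exprn_ge0//.
  by rewrite -natrX ler_nat leqnSn.
(* Two of the three powers pay for [c k <= N ^ k] and for [n k]; the third leaves a geometric
   series. *)
have decay (r : R) k : 0 <= r -> r < 1 ->
    c k * (n k)%:R * r ^+ (n k) <= 27 / (1 - r) ^+ 3 * N%:R^-1 ^+ k.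
  move=> r0 r1; have := expr_decay (n k) r0 r1 (m := 3) isT; rewrite nR.
  have ckn : c k <= N%:R ^+ k.
    by rewrite (le_trans (c_v k))// ler_piMl ?(ltW (NX _))// exprn_ile1// ltW.
  have r10 : 0 < 1 - r by rewrite subr_gt0.
  rewrite exprVn ler_pdivlMr// ler_pdivlMr ?exprn_gt0//.
  move: (NX k) ckn (c0 k) (exprn_ge0 (n k) r0).
  set X := N%:R ^+ k; set Y := r ^+ _; set C := c k => X0 CX C0 Y0 h.
  have -> : (27 : R) = 3%:R ^+ 3 by rewrite -natrX.
  apply: le_trans h.
  have -> : C * X * Y * X * (1 - r) ^+ 3 = C * (X * Y * X * (1 - r) ^+ 3) by ring.
  have -> : Y * (X * (1 - r)) ^+ 3 = X * (X * Y * X * (1 - r) ^+ 3) by ring.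
  by rewrite ler_wpM2r// !mulr_ge0// ?exprn_ge0// ltW.
have fex z : exists S : R[i], normc z < 1 -> forall e, 0 < e -> exists K0, forall K, (K0 <= K)%N
  ->
    normc (\sum_(k < K) (a k)%:C * z ^+ (n k).+1 - S) <= e.
  have [z1|] := boolP (normc z < 1); last by exists 0.
  have [|S HS] := @complex_series_ex R (fun k => (a k)%:C * z ^+ (n k).+1) 1 v v0 v1.
    move=> k; rewrite mul1r normcM normc_real normcX gtr0_norm//.
    by rewrite (le_trans _ (av k))// ler_piMr ?(ltW (a0 k))// exprn_ile1 ?normc_ge0// ltW.
  by exists S.
have gex z : exists S : R[i], normc z < 1 -> forall e, 0 < e -> exists K0, forall K, (K0 <= K)%N
  ->
    normc (\sum_(k < K) (c k)%:C * z ^+ (n k) - S) <= e.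
  have [z1|] := boolP (normc z < 1); last by exists 0.
  have [|S HS] := @complex_series_ex R (fun k => (c k)%:C * z ^+ (n k))
      (27 / (1 - normc z) ^+ 3) _ iN0 iN1.
    move=> k; rewrite normcM normc_real normcX gtr0_norm//.
    apply: le_trans (decay _ k (normc_ge0 z) z1).
    rewrite ler_wpM2r ?exprn_ge0 ?normc_ge0// ler_peMr ?(ltW (c0 k))//.
    by rewrite ler1n expn_gt0 (leq_trans _ N513).
  by exists S.
have [f fP] := choice fex; have [g gP] := choice gex.
exists f, g; split.
- move=> z z1 e e0.
  pose rho := (1 + normc z) / 2.
  have z0 := normc_ge0 z.
  have rho0 : 0 < rho by rewrite /rho; lra.
  have rho1 : rho < 1 by rewrite /rho; lra.
  have zrho : normc z < rho by rewrite /rho; lra.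
  pose B := (27 / (1 - rho) ^+ 3) * (1 - (N%:R)^-1)^-1.
  have B0 : 0 < B.
    by rewrite /B !mulr_gt0 ?invr_gt0 ?exprn_gt0// subr_gt0.
  have Bsum K : \sum_(k < K) c k * (n k)%:R * rho ^+ (n k) <= B.
    apply: (@le_trans _ _ (\sum_(k < K) 27 / (1 - rho) ^+ 3 * N%:R^-1 ^+ k)).
      by apply: ler_sum => k _; apply: decay => //; exact: ltW.
    rewrite -mulr_sumr ler_wpM2l ?geometric_sum_le//.
    by rewrite mulr_ge0// invr_ge0 exprn_ge0// subr_ge0 ltW.
  exists (Num.min (rho - normc z) (e * rho / B)).
    by rewrite lt_min subr_gt0 zrho/= divr_gt0// mulr_gt0.
  move=> h; rewrite lt_min => /andP[h1 h2].
  have wrho : normc (z + h) < rho by rewrite (le_lt_trans (normcD_le _ _))//; lra.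
  have w1 : normc (z + h) < 1 := lt_trans wrho rho1.
  (* Proved for partial sums, with a constant [B / rho] independent of [K]; three errors of [d / 3]
     pay for the passage to the limit. *)
  have Q : normc (f (z + h) - f z - g z * h) <= B / rho * normc h ^+ 2.
    apply/ler_addgt0Pr => d d0.
    have d3 : 0 < d / 3 by rewrite divr_gt0.
    have nh1 : 0 < normc h + 1 by rewrite ltr_wpDl ?normc_ge0.
    have [K1 H1] := fP _ w1 _ d3; have [K2 H2] := fP _ z1 _ d3.
    have [K3 H3] := gP _ z1 _ (divr_gt0 d3 nh1).
    pose K := maxn K1 (maxn K2 K3).
    have {}H1 := H1 K (leq_maxl _ _).
    have {}H2 := H2 K (leq_trans (leq_maxl _ _) (leq_maxr _ _)).
    have {}H3 := H3 K (leq_trans (leq_maxr _ _) (leq_maxr _ _)).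
    have H4 : normc (\sum_(k < K) (a k)%:C * (z + h) ^+ (n k).+1 -
       \sum_(k < K) (a k)%:C * z ^+ (n k).+1 - (\sum_(k < K) (c k)%:C * z ^+ (n k)) * h)
         <= B / rho * normc h ^+ 2.
      rewrite mulr_suml -!sumrB; apply: (le_trans (normc_sum _ _ _)).
      rewrite mulrAC ler_pdivlMr// mulr_suml.
      apply: le_trans (_ : \sum_(k < K) (c k * (n k)%:R * rho ^+ (n k)) * normc h ^+ 2 <= _);
        last first.
        by rewrite -mulr_suml ler_wpM2r ?sqr_ge0.
      apply: ler_sum => k _.
      have -> : (a k)%:C * (z + h) ^+ (n k).+1 - (a k)%:C * z ^+ (n k).+1 - (c k)%:C * z ^+ n k
        * h =
        (a k)%:C * ((z + h) ^+ (n k).+1 - z ^+ (n k).+1 - (n k).+1%:R * z ^+ n k * ((z + h) - z)).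
        have -> : (c k)%:C = (a k)%:C * (n k).+1%:R :> R[i].
          by rewrite -(rmorph_nat (real_complex R)) -(rmorphM (real_complex R)) an.
        by rewrite (addrAC z) subrr add0r; ring.
      rewrite normcM normc_real gtr0_norm// -[leLHS]mulrA [normc _ * rho]mulrC.
      apply: (le_trans (ler_wpM2l (ltW (a0 k)) (normc_taylor1 (n k) (ltW wrho) (ltW zrho)))).
      rewrite (addrAC z) subrr add0r mulrA ler_wpM2r ?sqr_ge0//.
      rewrite mulrA ler_wpM2r ?exprn_ge0 ?(ltW rho0)// expr2 mulrA ler_wpM2r//.
      by rewrite -(an k) ler_wpM2l ?(ltW (a0 k))// ler_nat.
    set F := \sum_(k < K) _ in H1 H4; set F' := \sum_(k < K) _ in H2 H4; set G := \sum_(k < K) _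
      in H3 H4.
    rewrite (_ : _ - _ = (F - F' - G * h) - (F - f (z + h)) + (F' - f z) + (G - g z) * h); last
      by ring.
    have H5 : normc ((G - g z) * h) <= d / 3.
      rewrite normcM; apply: (le_trans (ler_wpM2r (normc_ge0 _) H3)).
      rewrite -mulrA ler_piMr ?(ltW d3)// mulrC ler_pdivrMr// mul1r lerDl//.
    rewrite (le_trans (normcD_le _ _))//.
    have := normcD_le (F - F' - G * h - (F - f (z + h))) (F' - f z).
    have := normcB_le (F - F' - G * h) (F - f (z + h)).
    lra.
  apply: (le_trans Q); rewrite expr2 mulrA ler_wpM2r ?normc_ge0//.
  by rewrite mulrC mulrA ler_pdivrMr// -ler_pdivlMr// ltW.
- move=> z z1; apply/ler_addgt0Pr => d d0; have [K HK] := fP _ z1 _ d0.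
  rewrite -(subrK (\sum_(k < K) (a k)%:C * z ^+ (n k).+1) (f z)) (le_trans (normcD_le _ _))//.
  rewrite addrC lerD//; last by rewrite normc_distC HK.
  apply: le_trans (geometric_sum_le K v0 v1).
  apply: (le_trans (normc_sum _ _ _)); apply: ler_sum => k _.
  rewrite normcM normc_real normcX gtr0_norm// (le_trans _ (av k))//.
  by rewrite ler_piMr ?(ltW (a0 k))// exprn_ile1 ?normc_ge0// ltW.
- move=> z k z1 zk; apply/ler_addgt0Pr => d d0; have [K HK] := gP _ z1 _ d0.
  have {}HK := HK (maxn K k.+1) (leq_maxl _ _).
  have := lacunary_partial z1 zk (leq_maxr K k.+1).
  move: HK; set S := \sum_(_ < _) _ => HK h.
  rewrite (le_trans (normc_distD S _ _))// addrC lerD// normc_distC.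
  exact: HK.
Qed.

End LacunarySeries.

(** * Choice of the coefficients and of the ratio [N] *)

Section Coefficients.
Context {R : realType}.
Implicit Types (p q beta sigma : R).

Lemma ltr_powR (a x y : R) : 1 < a -> x < y -> a `^ x < a `^ y.
Proof.
move=> a1 xy; have a0 : a == 0 = false by rewrite gt_eqF// (lt_trans ltr01).
by rewrite /powR a0 ltr_expR ltr_pM2r// ln_gt0.
Qed.

(** Telescoping: the mean value theorem for [t ^ (1 - q)] bounds [(x + 1) ^ (- q)] by [(x ^ (1 - q)
    - (x + 1) ^ (1 - q)) / (q - 1)]. *)
Lemma sum_powRN_le q K : 1 < q ->
  \sum_(k < K) k.+1%:R `^ (- q) <= 1 + (q - 1)^-1 :> R.
Proof.
move=> q1; have e0 : 0 < q - 1 by rewrite subr_gt0.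
case: K => [|K]; first by rewrite big_ord0 addr_ge0// invr_ge0 ltW.
apply: (@le_trans _ _ (1 + (1 - K.+1%:R `^ (1 - q)) / (q - 1))); last first.
  by rewrite lerD2l ler_pdivrMr// mulVf ?gt_eqF// lerBlDr lerDl powR_ge0.
elim: K => [|K IH]; first by rewrite big_ord_recr big_ord0 /= !powR1 subrr mul0r addr0 add0r.
rewrite big_ord_recr /=; apply: (le_trans (lerD IH (lexx _))).
rewrite -addrA lerD2l.
have x0 : 0 < K.+1%:R :> R by rewrite ltr0n.
have -> : K.+2%:R = K.+1%:R + 1 :> R by rewrite natr1.
move: (K.+1%:R : R) x0 => x x0.
have [|c|c|c] := @MVT R (fun t => t `^ (1 - q)) (fun t => (1 - q) * t `^ (1 - q - 1)) x (x + 1).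
- by rewrite ltrDl.
- by rewrite in_itv/= => /andP[xc _]; apply: is_derive1_powR; exact: lt_trans xc.
- move: c; apply: derivable_within_continuous => c; rewrite in_itv/= => /andP[xc _].
  by apply: ex_derive; apply: is_derive1_powR; exact: lt_le_trans xc.
rewrite in_itv/= => /andP[xc cx]; rewrite (addrC x 1) addrK mulr1 => E.
have c0 := lt_trans x0 xc.
have : (1 + x) `^ (1 - q - 1) <= c `^ (1 - q - 1).
  rewrite (_ : 1 - q - 1 = - q); last by ring.
  rewrite !powRN lef_pV2 ?posrE ?powR_gt0// ?addr_gt0//.
  by rewrite ge0_ler_powR ?nnegrE ?(ltW c0)// ?addr_ge0// ?(ltW x0)// ?(addrC 1)// ltW//
    (lt_trans ltr01).
move=> /(ler_wpM2r (ltW e0)) h.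
have E' : c `^ (1 - q - 1) * (q - 1) = x `^ (1 - q) - (1 + x) `^ (1 - q).
  by rewrite -[RHS]opprB E; ring.
have e1 : 1 - q - 1 = - q by ring.
by rewrite e1 in h E'; rewrite -lerBrDl -mulrBl ler_pdivlMr// (le_trans h)// E'; lra.
Qed.

Lemma lacunary_coefficients p beta sigma : 0 < p -> 0 < beta -> beta < 1 ->
  2 * beta < 1 + sigma \/ (p < 2 /\ 2 * beta = 1 + sigma) ->
  exists N (c : nat -> R) v C,
    [/\ (513 <= N)%N, forall k, 0 < c k,
       forall k, 9 * c k <= c k.+1, forall k, c k.+1 <= N%:R * c k &
       [/\ 0 <= v, v < 1, forall k, c k <= v ^+ k * N%:R ^+ k,
        forall k, (c k) `^ p = (N%:R ^+ k) `^ (p * beta) / k.+1%:R &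
        forall K, \sum_(k < K) c k ^+ 2 * ((N%:R ^+ k)^-1 `^ (1 + sigma)) <= C]].
Proof.
move=> p0 b0 b1 hs.
(* One step in [k] shrinks [d k] by a factor of at most [2 ^ (1 / p)], so [Y <= w] secures the
   ninefold growth of [w ^ k * d k]. *)
pose Y : R := 9 * 2 `^ p^-1.
have Y0 : 0 < Y by rewrite mulr_gt0// powR_gt0.
have [N N513 NY] : exists2 N, (513 <= N)%N & Y `^ beta^-1 <= N%:R.
  exists (maxn 513 (Num.bound (Y `^ beta^-1))); first by rewrite leq_maxl.
  apply: le_trans (ltW (archi_boundP _)) _; first exact: powR_ge0.
  by rewrite ler_nat leq_maxr.
have N0 : 0 < N%:R :> R by rewrite ltr0n (leq_trans _ N513).
have N1 : 1 < N%:R :> R by rewrite ltr1n (leq_trans _ N513).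
pose w := N%:R `^ beta : R.
have w0 : 0 < w by rewrite powR_gt0.
have wY : Y <= w.
  have -> : Y = (Y `^ beta^-1) `^ beta by rewrite -powRrM mulVf ?gt_eqF// powRr1// ltW.
  by rewrite ge0_ler_powR ?nnegrE ?powR_ge0 ?(ltW b0) ?(ltW N0).
have wN : w < N%:R.
  by rewrite -[ltRHS]powRr1 ?(ltW N0)// ltr_powR.
pose d k : R := k.+1%:R `^ (- p^-1).
have d0 k : 0 < d k by rewrite powR_gt0.
have d1 k : d k <= 1.
  by rewrite /d powRN invf_le1 ?powR_gt0// -[leLHS](powRr0 k.+1%:R) ler_powR ?invr_ge0 ?(ltW
    p0)// ler1n.
have ip0 : 0 < p^-1 by rewrite invr_gt0.
have dS k : d k.+1 <= d k.
  rewrite /d !powRN lef_pV2 ?posrE ?powR_gt0//.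
  by rewrite ge0_ler_powR ?nnegrE ?(ltW ip0)// ler_nat.
have dS' k : d k <= 2 `^ p^-1 * d k.+1.
  rewrite /d !powRN -ler_pdivrMl ?powR_gt0// -invfM lef_pV2 ?posrE ?mulr_gt0 ?powR_gt0//.
  rewrite -powRM// ge0_ler_powR ?nnegrE ?(ltW ip0)//.
  by have := ler0n R k; rewrite -!natr1; lra.
exists N, (fun k => w ^+ k * d k), (w / N%:R).
have wX k : w ^+ k = (N%:R ^+ k) `^ beta.
  by rewrite -(powR_mulrn k (ltW w0)) -(powR_mulrn k (ltW N0)) /w -[LHS]powRrM -[RHS]powRrM mulrC.
have ck k (e : R) : (N%:R ^+ k)^-1 `^ e = (N%:R `^ (- e)) ^+ k.
  have Nk0 : 0 <= N%:R ^+ k :> R by rewrite exprn_ge0// ltW.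
  rewrite -(powR_inv1 Nk0) -(powR_mulrn k (ltW N0)) -(powR_mulrn k (powR_ge0 _ _)).
  by rewrite -[RHS]powRrM -[LHS]powRrM -[LHS]powRrM; congr (_ `^ _); ring.
pose x : R := N%:R `^ (2 * beta - (1 + sigma)).
have x0 : 0 <= x by exact: powR_ge0.
have termE k : (w ^+ k * d k) ^+ 2 * (N%:R ^+ k)^-1 `^ (1 + sigma) = x ^+ k * k.+1%:R `^ (- (2 /
  p)).
  rewrite exprMn mulrAC ck -exprM mulnC exprM -exprMn.
  congr (_ ^+ _ * _).
    rewrite /w /x -powR_mulrn ?powR_ge0// -powRrM -powRD; last by rewrite (gt_eqF N0) implybT.
    by congr (_ `^ _); ring.
  by rewrite /d -powR_mulrn ?powR_ge0// -powRrM; congr (_ `^ _); ring.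
(* Strict inequality in the hypothesis gives [x < 1] and a geometric bound. In the equality case
   [x = 1], and [p < 2] makes the exponent [2 / p] exceed 1. *)
exists (if x < 1 then (1 - x)^-1 else 1 + (2 / p - 1)^-1).
split => //.
- by move=> k; rewrite mulr_gt0// exprn_gt0.
- move=> k; rewrite exprS -mulrA mulrCA [leRHS]mulrCA ler_wpM2l ?exprn_ge0 ?(ltW w0)//.
  apply: (le_trans (ler_wpM2l _ (dS' k))) => //.
  by rewrite mulrA ler_wpM2r ?(ltW (d0 _)).
- move=> k; rewrite exprS -mulrA; apply: ler_pM.
  + exact: ltW.
  + by rewrite mulr_ge0 ?exprn_ge0// ltW.
  + exact: ltW.
  + by rewrite ler_wpM2l// exprn_ge0// ltW.
split.
- by rewrite divr_ge0 ?ltW.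
- by rewrite ltr_pdivrMr// mul1r.
- by move=> k; rewrite -exprMn divfK ?gt_eqF// ler_piMr// exprn_ge0// ltW.
- move=> k; rewrite powRM ?exprn_ge0 ?(ltW w0) ?(ltW (d0 _))// wX -powRrM (mulrC beta); congr (_
  * _).
  by rewrite /d -powRrM mulNr mulVf ?gt_eqF// powRN powRr1.
- move=> K; under eq_bigr do rewrite termE.
  case: ifPn => x1.
    apply: le_trans (geometric_sum_le K x0 x1); apply: ler_sum => k _.
    rewrite ler_piMr ?exprn_ge0// powRN invf_le1 ?powR_gt0//.
    by rewrite -[leLHS](powRr0 k.+1%:R) ler_powR ?ler1n// divr_ge0 ?(ltW p0).
  case: hs => [h|[p2 h]].
    have : x < N%:R `^ 0 by rewrite ltr_powR// subr_lt0.
    by rewrite powRr0 (negbTE x1).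
  have -> : x = 1 by rewrite /x h subrr powRr0.
  under eq_bigr do rewrite expr1n mul1r.
  by apply: sum_powRN_le; rewrite ltr_pdivlMr// mul1r.
Qed.

End Coefficients.

(** * Integrals over annular regions *)

Section ProductMeasure.
Context {R : realType}.
Local Notation lambda := (@lebesgue_measure R).
Local Notation mu2 := (lambda \x lambda)%E.
Implicit Types (a b l : R) (h : R -> R).

(** A graph thickened vertically by [l]. Its area [(b - a) * l] does not depend on [h], so thin
    curved regions along a circle are measured without polar coordinates. *)
Definition vstrip a b h l : set (R * R) :=
  [set w | a <= w.1 <= b /\ h w.1 <= w.2 <= h w.1 + l].
Definition hstrip a b h l : set (R * R) :=
  [set w | a <= w.2 <= b /\ h w.2 <= w.1 <= h w.2 + l].

Lemma measurable_vstrip a b h l : measurable_fun setT h -> measurable (vstrip a b h l).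
Proof.
move=> mh.
have mF : measurable_fun setT (fun w : R * R => w.2 - h w.1).
  by apply: measurable_funB; [exact: measurable_snd|exact: measurableT_comp mh measurable_fst].
have -> : vstrip a b h l = fst @^-1` `[a, b] `&` (fun w : R * R => w.2 - h w.1) @^-1` `[0, l].
  by apply/seteqP; split => -[x y] /=; rewrite /preimage/= !in_itv/= subr_ge0 lerBlDl.
apply: measurableI.
- by rewrite -[X in measurable X]setTI; exact: measurable_fst.
- by rewrite -[X in measurable X]setTI; exact: mF.
Qed.

Lemma measurable_hstrip a b h l : measurable_fun setT h -> measurable (hstrip a b h l).
Proof.
move=> mh.
have mF : measurable_fun setT (fun w : R * R => w.1 - h w.2).
  by apply: measurable_funB; [exact: measurable_fst|exact: measurableT_comp mh measurable_snd].
have -> : hstrip a b h l = snd @^-1` `[a, b] `&` (fun w : R * R => w.1 - h w.2) @^-1` `[0, l].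
  by apply/seteqP; split => -[x y] /=; rewrite /preimage/= !in_itv/= subr_ge0 lerBlDl.
apply: measurableI.
- by rewrite -[X in measurable X]setTI; exact: measurable_snd.
- by rewrite -[X in measurable X]setTI; exact: mF.
Qed.

Lemma integral_strip a b l : a <= b -> 0 <= l ->
  (\int[lambda]_x (l%:E * (\1_(`[a, b]) x)%:E) = ((b - a) * l)%:E)%E.
Proof.
move=> ab l0; rewrite ge0_integralZl//; last by apply/measurable_EFinP.
rewrite integral_indic// setIT /= lebesgue_measure_itv/= lte_fin.
have [ab'|ba] := ltP a b; first by rewrite -EFinB -EFinM mulrC.
have -> : a = b by apply/le_anti; rewrite ab ba.
by rewrite mule0 subrr mul0r.
Qed.

Lemma vstrip_measure a b h l : a <= b -> 0 <= l -> measurable_fun setT h ->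
  mu2 (vstrip a b h l) = ((b - a) * l)%:E.
Proof.
move=> ab l0 mh; rewrite /product_measure1 /=.
transitivity (\int[lambda]_x (l%:E * (\1_(`[a, b]) x)%:E))%E; last exact: integral_strip.
apply: eq_integral => x _; rewrite indicE; have [xab|xab] := boolP (x \in `[a, b]%classic).
  rewrite mule1 /=.
  have -> : xsection (vstrip a b h l) x = `[h x, h x + l]%classic.
    apply/seteqP; split => y /=; rewrite /xsection/= inE /vstrip /= in_itv/=.
      by move=> [].
    by move=> h1; split => //; move: xab; rewrite inE/= in_itv.
  rewrite lebesgue_measure_itv/= lte_fin ltrDl -EFinD addrAC subrr add0r.
  by case: ltgtP l0 => // <-.
rewrite mule0 /=.
have -> : xsection (vstrip a b h l) x = set0.
  apply/seteqP; split => y //=; rewrite /xsection/= inE /vstrip /= => -[h1 _].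
  by move/negP: xab; apply; rewrite inE/= in_itv.
by rewrite measure0.
Qed.

(** Here the horizontal sections are intervals, whereas [\x] integrates vertical ones; uniqueness of
    the product measure permits the other order of integration. *)
Lemma hstrip_measure a b h l : a <= b -> 0 <= l -> measurable_fun setT h ->
  mu2 (hstrip a b h l) = ((b - a) * l)%:E.
Proof.
move=> ab l0 mh.
have mS := measurable_hstrip a b l mh.
rewrite (@product_measure_unique _ _ _ _ _ _ _ (lambda \x^ lambda)%E _ _ mS); last first.
  by move=> A B mA mB; exact: product_measure2E.
rewrite /product_measure2 /=.
transitivity (\int[lambda]_x (l%:E * (\1_(`[a, b]) x)%:E))%E; last exact: integral_strip.
apply: eq_integral => x _; rewrite indicE; have [xab|xab] := boolP (x \in `[a, b]%classic).
  rewrite mule1 /=.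
  have -> : ysection (hstrip a b h l) x = `[h x, h x + l]%classic.
    apply/seteqP; split => y /=; rewrite /ysection/= inE /hstrip /= in_itv/=.
      by move=> [].
    by move=> h1; split => //; move: xab; rewrite inE/= in_itv.
  rewrite lebesgue_measure_itv/= lte_fin ltrDl -EFinD addrAC subrr add0r.
  by case: ltgtP l0 => // <-.
rewrite mule0 /=.
have -> : ysection (hstrip a b h l) x = set0.
  apply/seteqP; split => y //=; rewrite /ysection/= inE /hstrip /= => -[h1 _].
  by move/negP: xab; apply; rewrite inE/= in_itv.
by rewrite measure0.
Qed.


End ProductMeasure.

Lemma nneseries_ge_term (R : realType) (u : nat -> \bar R) j :
  (forall i, 0 <= u i)%E -> (u j <= \sum_(i <oo) u i)%E.
Proof.
move=> u0; apply: le_trans (nneseries_lim_ge j.+1 _) => //.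
by rewrite big_mkord big_ord_recr /= leeDr// sume_ge0.
Qed.

Section NonnegativeIntegral.
Context d (T : measurableType d) (R : realType).
Variable mu : {measure set T -> \bar R}.
Local Open Scope ereal_scope.

(** Monotonicity is read off the definition as a supremum over simple functions, so it covers
    arbitrary nonnegative integrands, in particular those built from [cderiv f]. *)
Lemma le_integral_nonneg (f g : T -> \bar R) :
  (forall x, 0 <= f x) -> (forall x, f x <= g x) ->
  \int[mu]_x f x <= \int[mu]_x g x.
Proof.
move=> f0 fg; have g0 x : 0 <= g x by exact: le_trans (fg x).
rewrite !ge0_integralTE//; apply: le_ereal_sup => _ /= [h hf <-].
by exists h => // x; exact: le_trans (fg x).
Qed.

Lemma integral_cindic (A : set T) (q : R) : measurable A -> (0 <= q)%R ->
  \int[mu]_x (q * \1_A x)%:E = q%:E * mu A.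
Proof.
move=> mA q0; under eq_integral do rewrite EFinM.
rewrite ge0_integralZl//; last by apply/measurable_EFinP.
by rewrite integral_indic// setIT.
Qed.

Let mqA (A : set T) (q : R) : measurable A -> measurable_fun setT (fun x => (q * \1_A x)%:E).
Proof. by move=> mA; apply/measurable_EFinP; exact: measurable_funM. Qed.

Lemma integral_disjoint_ge (D : set T) (F : T -> R) (B : nat -> set T) (q m : nat -> R) :
  (forall x, D x -> 0 <= F x)%R -> (forall k, measurable (B k)) -> (forall k, B k `<=` D) ->
  trivIset setT B -> (forall k, 0 <= q k)%R -> (forall k x, B k x -> q k <= F x)%R ->
  (forall k, (m k)%:E <= mu (B k)) ->
  forall K, (\sum_(k < K) q k * m k)%:E <= \int[mu]_(x in D) (F x)%:E.
Proof.
move=> F0 mB BD tB q0 qF mm K; rewrite integral_mkcond.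
apply: (@le_trans _ _ (\int[mu]_x \sum_(k < K) (q k * \1_(B k) x)%:E)).
  rewrite ge0_integral_sum//; last 2 first.
  - by move=> k; exact: mqA.
  - by move=> k x _; rewrite lee_fin mulr_ge0.
  rewrite -sumEFin; apply: lee_sum => k _.
  by rewrite integral_cindic// EFinM lee_wpmul2l// lee_fin.
apply: le_integral_nonneg => x.
  by apply: sume_ge0 => k _; rewrite lee_fin mulr_ge0.
have F0' : 0 <= ((fun x => (F x)%:E) \_ D) x.
  by rewrite patchE; case: ifPn => // /set_mem; rewrite lee_fin; exact: F0.
have [[k Bk]|nB] := pselect (exists k : 'I_K, B k x).
  rewrite (bigD1 k)//= big1 ?adde0; last first.
    move=> j jk; rewrite indicE memNset ?mulr0// => Bj.
    by move/eqP: jk; apply; apply: val_inj; apply: tB => //; exists x.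
  rewrite indicE mem_set// mulr1 patchE mem_set ?lee_fin; last exact: BD Bk.
  exact: qF.
rewrite big1// => j _; rewrite indicE memNset ?mulr0// => Bj.
by apply: nB; exists j.
Qed.

(** Each point chooses one index [(k, j)], and [q k j] has to bound [F] only at the points that
    chose it. The sets [S k j] may thus be larger than the regions on which the estimates hold. *)
Lemma integral_cover_le (D : set T) (F : T -> R) (S : nat -> nat -> set T)
    (q m : nat -> nat -> R) (e : nat -> R) (C : R) :
  (forall x, D x -> 0 <= F x)%R -> (forall k j, measurable (S k j)) -> (forall k j, 0 <= q k
    j)%R ->
  (forall x, D x -> exists k j, S k j x /\ (F x <= q k j)%R) ->
  (forall k j, mu (S k j) <= (m k j)%:E) ->
  (forall k J, \sum_(j < J) q k j * m k j <= e k)%R -> (forall K, \sum_(k < K) e k <= C)%R ->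
  \int[mu]_(x in D) (F x)%:E <= C%:E.
Proof.
move=> F0 mS q0 FS mm me eC; rewrite integral_mkcond.
pose G k x := \sum_(j <oo) (q k j * \1_(S k j) x)%:E.
have t0 k j x : 0 <= (q k j * \1_(S k j) x)%:E by rewrite lee_fin mulr_ge0.
have G0 k x : 0 <= G k x by apply: nneseries_ge0.
apply: (@le_trans _ _ (\int[mu]_x \sum_(k <oo) G k x)).
  apply: le_integral_nonneg => x; rewrite patchE; case: ifPn => [/set_mem Dx|_].
  - by rewrite lee_fin F0.
  - by [].
  - have [k [j [Sx Fq]]] := FS x Dx.
    apply: (@le_trans _ _ (q k j * \1_(S k j) x)%:E).
      by rewrite indicE mem_set// mulr1 lee_fin.
    apply: (@le_trans _ _ (G k x)).
      exact: (nneseries_ge_term j (fun i => t0 k i x)).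
    exact: (nneseries_ge_term k (fun i => G0 i x)).
  - by apply: nneseries_ge0.
have mG k : measurable_fun setT (G k).
  by apply: ge0_emeasurable_sum => // j *; exact: mqA.
rewrite integral_nneseries//.
apply: lime_le; first by apply: is_cvg_nneseries => k _ _; exact: integral_ge0.
apply: nearW => K; rewrite big_mkord.
apply: (@le_trans _ _ (\sum_(k < K) e k)%:E); last by rewrite lee_fin.
rewrite -sumEFin; apply: lee_sum => k _.
rewrite integral_nneseries//; last by move=> j; exact: mqA.
apply: lime_le; first by apply: is_cvg_nneseries => j _ _; exact: integral_ge0.
apply: nearW => J; rewrite big_mkord.
apply: (@le_trans _ _ (\sum_(j < J) q k j * m k j)%:E); last by rewrite lee_fin.
rewrite -sumEFin; apply: lee_sum => j _.
by rewrite integral_cindic// EFinM lee_wpmul2l// lee_fin.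
Qed.

End NonnegativeIntegral.

(** * Thin strips along circles *)

Section AnnularRegions.
Context {R : realType}.
Local Notation lambda := (@lebesgue_measure R).
Local Notation mu2 := (lambda \x lambda)%E.
Implicit Types (x y : R) (w : R * R) (a : R[i]).

Definition semicircle r x : R := Num.sqrt (r ^+ 2 - x ^+ 2).

Lemma measurable_semicircle r : measurable_fun setT (semicircle r).
Proof.
apply: continuous_measurable_fun => x; apply: (@continuous_comp _ _ _ (fun x => r ^+ 2 - x ^+ 2)).
  apply: cvgB; first exact: cvg_cst.
  exact: exprn_continuous.
exact: sqrt_continuous.
Qed.

(** With [h = semicircle 1 x], one has [h ^ 2 - y ^ 2 = 1 - r ^ 2 <= 2 d]. If [h - |y|] exceeded
    [3 d], then [d < 1 / 3], so [|x| <= |y|] would force [|y| > 2 / 5] and [h + |y| > 4 / 5], and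
    the product would exceed [2 d]. *)
Lemma semicircle_near x y d : 0 < d -> normc (x +i* y) < 1 -> 1 - normc (x +i* y) <= d ->
  `|x| <= `|y| -> semicircle 1 x - 3 * d <= `|y| <= semicircle 1 x.
Proof.
move=> d0; have := normc_ge0 (x +i* y); have := normc_sqr (x +i* y).
move: (normc _) => r /= r2 r0 r1 rd xy.
have x2 : `|x| ^+ 2 = x ^+ 2 by rewrite real_normK ?num_real.
have y2 : `|y| ^+ 2 = y ^+ 2 by rewrite real_normK ?num_real.
have xy2 : x ^+ 2 <= y ^+ 2 by rewrite -x2 -y2 lerXn2r ?nnegrE.
have h0 : 0 <= 1 ^+ 2 - x ^+ 2 by rewrite expr1n subr_ge0; nra.
have hh : semicircle 1 x ^+ 2 = 1 - x ^+ 2 by rewrite sqr_sqrtr// expr1n.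
have h1 : 0 <= semicircle 1 x by exact: sqrtr_ge0.
move: (semicircle 1 x) h1 hh => h h1 hh.
rewrite -y2 in r2 xy2; move: `|y| (normr_ge0 y) r2 xy2 {xy y2} => Y Y0 r2 xy2.
apply/andP; split; last by rewrite -ler_sqr ?nnegrE//; nra.
rewrite leNgt; apply/negP => hY.
have d3 : d < 3^-1 by nra.
have Y4 : 2 / 5 < Y by rewrite ltNge; apply/negP => ?; nra.
nra.
Qed.

(** Four strips of length [2 * rho] and thickness [3 * d] follow the upper, lower, right and left
    arcs of the unit circle. A point is assigned by comparing [|x|] with [|y|], so that the arc in
    question is never steep there. *)
Lemma annulus_ball_cover d rho a : 0 < d -> 0 <= rho -> exists T : set (R * R),
  [/\ measurable T, (mu2 T <= (24 * d * rho)%:E)%E &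
    forall w, normc (w.1 +i* w.2) < 1 -> 1 - normc (w.1 +i* w.2) <= d ->
      normc (w.1 +i* w.2 - a) <= rho -> T w].
Proof.
move=> d0 rho0.
pose h1 x := semicircle 1 x - 3 * d; pose h2 x := - semicircle 1 x.
have m1 : measurable_fun setT h1.
  by apply: measurable_funB => //; exact: measurable_semicircle.
have m2 : measurable_fun setT h2.
  by apply: measurableT_comp => //; exact: measurable_semicircle.
pose u := complex.Re a; pose v := complex.Im a.
pose V h := vstrip (u - rho) (u + rho) h (3 * d).
pose H h := hstrip (v - rho) (v + rho) h (3 * d).
have d30 : 0 <= 3 * d by rewrite mulr_ge0// ltW.
have rr (t : R) : t - rho <= t + rho by rewrite lerD2l (le_trans _ rho0)// oppr_le0.
have mV h : measurable_fun setT h -> measurable (V h) /\ (mu2 (V h) <= (6 * d * rho)%:E)%E.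
  move=> mh; split; first exact: measurable_vstrip.
  by rewrite vstrip_measure// lee_fin le_eqVlt; apply/orP; left; apply/eqP; ring.
have mH h : measurable_fun setT h -> measurable (H h) /\ (mu2 (H h) <= (6 * d * rho)%:E)%E.
  move=> mh; split; first exact: measurable_hstrip.
  by rewrite hstrip_measure// lee_fin le_eqVlt; apply/orP; left; apply/eqP; ring.
have [a1 b1] := mV _ m1; have [a2 b2] := mV _ m2; have [a3 b3] := mH _ m1; have [a4 b4] := mH _
  m2.
have U2 (A B : set (R * R)) (x : R) y : measurable A -> measurable B ->
    (mu2 A <= x%:E -> mu2 B <= y%:E -> mu2 (A `|` B) <= (x + y)%:E)%E.
  move=> mA mB Ax By; rewrite EFinD; apply: le_trans (leeD Ax By).
  exact: measureU2.
exists ((V h1 `|` V h2) `|` (H h1 `|` H h2)); split.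
- by apply: measurableU; exact: measurableU.
- have -> : 24 * d * rho = (6 * d * rho + 6 * d * rho) + (6 * d * rho + 6 * d * rho) by ring.
  move: (6 * d * rho) b1 b2 b3 b4 => r b1 b2 b3 b4.
  have c1 := U2 _ _ _ _ a1 a2 b1 b2; have c2 := U2 _ _ _ _ a3 a4 b3 b4.
  exact: (U2 _ _ _ _ (measurableU _ _ a1 a2) (measurableU _ _ a3 a4) c1 c2).
move=> [x y] /= z1 zd za.
have := le_trans (normc_Re _) za; rewrite ReB /= ler_norml => /andP[x1 x2].
have := le_trans (normc_Im _) za; rewrite ImB /= ler_norml => /andP[y1 y2].
have xi : u - rho <= x <= u + rho by rewrite /u; apply/andP; split; lra.
have yi : v - rho <= y <= v + rho by rewrite /v; apply/andP; split; lra.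
have [xy|/ltW yx] := leP `|x| `|y|.
  left; have /andP[n1 n2] := semicircle_near d0 z1 zd xy.
  have [y0|/ltW y0] := leP 0 y.
    rewrite ger0_norm// in n1 n2.
    by left; split => //; rewrite /= /h1 n1 subrK.
  rewrite ler0_norm// in n1 n2.
  by right; split => //=; rewrite /h2; apply/andP; split; lra.
have swap : normc (y +i* x) = normc (x +i* y) by rewrite /= addrC.
have z1' : normc (y +i* x) < 1 by rewrite swap; exact: z1.
have zd' : 1 - normc (y +i* x) <= d by rewrite swap; exact: zd.
right; have /andP[n1 n2] := semicircle_near d0 z1' zd' yx.
have [x0|/ltW x0] := leP 0 x.
  rewrite ger0_norm// in n1 n2.
  by left; split => //; rewrite /= /h1 n1 subrK.
rewrite ler0_norm// in n1 n2.
by right; split => //=; rewrite /h2; apply/andP; split; lra.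
Qed.

(** The strip stands on the arc of radius [1 - 2 * eta] over [[0, 1 / 2]], a range that this arc
    covers since [1 - 2 * eta >= 1 / 2]. Its height [eta / 2] keeps it within radius [1 - eta]. *)
Lemma annulus_strip eta : 0 < eta -> eta <= 4^-1 -> exists B : set (R * R),
  [/\ measurable B, ((eta / 4)%:E <= mu2 B)%E &
    forall w, B w -> eta <= 1 - normc (w.1 +i* w.2) <= 2 * eta].
Proof.
move=> e0 e4; exists (vstrip 0 (2^-1) (semicircle (1 - 2 * eta)) (eta / 2)).
have e20 : 0 <= eta / 2 by rewrite divr_ge0// ltW.
split.
- by apply: measurable_vstrip; exact: measurable_semicircle.
- rewrite vstrip_measure//; last exact: measurable_semicircle.
  by rewrite lee_fin le_eqVlt; apply/orP; left; apply/eqP; field.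
move=> [x y] [/= /andP[x0 x1]]; rewrite -/(normc (x +i* y)).
have h2 : semicircle (1 - 2 * eta) x ^+ 2 = (1 - 2 * eta) ^+ 2 - x ^+ 2.
  by rewrite sqr_sqrtr// subr_ge0 lerXn2r ?nnegrE//; lra.
have h0 : 0 <= semicircle (1 - 2 * eta) x by exact: sqrtr_ge0.
move: (semicircle _ x) h2 h0 => h h2 h0 /andP[y1 y2].
have := normc_ge0 (x +i* y); have := normc_sqr (x +i* y).
move: (normc _) => r /= r2 r0.
have h1 : h <= 1 by nra.
apply/andP; split.
  have e1 : 0 <= 1 - eta by lra.
  suff : r <= 1 - eta by lra.
  rewrite -ler_sqr ?nnegrE//.
  have : y ^+ 2 <= (h + eta / 2) ^+ 2 by rewrite lerXn2r ?nnegrE//; lra.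
  nra.
have e1 : 0 <= 1 - 2 * eta by lra.
suff : 1 - 2 * eta <= r by lra.
rewrite -ler_sqr ?nnegrE//.
have : h ^+ 2 <= y ^+ 2 by rewrite lerXn2r ?nnegrE//; lra.
lra.
Qed.

End AnnularRegions.

(** * The test function in the two spaces *)

Section Preliminaries.
Context {R : realType}.
Implicit Types (x y e r d s T D : R) (z a c : R[i]).

Lemma eps_is_derive (f : R -> R) x l :
  (forall e, 0 < e -> exists2 d, 0 < d & forall h : R, `|h| < d -> `|f (x + h) - f x - l * h| <=
    e * `|h|) ->
  is_derive x 1 f l.
Proof.
move=> H.
have fl : h^-1 *: ((f \o shift x) (h *: 1) - f x) @[h --> 0^'] --> l.
  apply/cvgrPdist_le => e e0; have [d d0 Hd] := H e e0.
  exists d => //= h /=; rewrite sub0r normrN => hd h0.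
  rewrite -(ler_pM2r (x := `|h|)) ?normr_gt0// -normrM (le_trans _ (Hd _ hd))//.
  rewrite -normrN mulrBl [_ *: _]/(_ * _) mulrAC mulVf// mul1r opprB.
  by rewrite [h *: 1]mulr1 (addrC h).
by split; [apply/cvg_ex; exists l|exact: cvg_lim].
Qed.

Lemma entire_cderiv0_cst (phi : R[i] -> R[i]) : entire phi ->
  (forall z, cderiv phi z = 0) -> forall z, phi z = phi 0.
Proof.
move=> phiE phi0 z.
have cd t e : 0 < e -> exists2 d, 0 < d & forall h : R, `|h| < d ->
    normc (phi ((t + h)%:C * z) - phi (t%:C * z)) <= e * `|h|.
  move=> e0; have K0 : 0 < normc z + 1 by rewrite ltr_wpDl ?normc_ge0.
  have [d d0 H] := entire_cdiff (t%:C * z) phiE (divr_gt0 e0 K0).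
  exists (d / (normc z + 1)); first by rewrite divr_gt0.
  move=> h hd; have := H (h%:C * z).
  rewrite phi0 mul0r subr0 normcM normc_real -mulrDl -(rmorphD (real_complex R)) => H1.
  have hz : `|h| * normc z <= `|h| * (normc z + 1) by rewrite ler_wpM2l// lerDl.
  rewrite ltr_pdivlMr// in hd.
  apply: (le_trans (H1 (le_lt_trans hz hd))).
  rewrite mulrAC ler_pdivrMr// -mulrA ler_wpM2l ?(ltW e0)//.
have cst (u : R -> R) : (forall x y, `|u x - u y| <= normc (phi (x%:C * z) - phi (y%:C * z))) ->
  u 1 = u 0.
  move=> hu; apply: is_derive_0_is_cst => t; apply: eps_is_derive => e e0.
  have [d d0 H] := cd t e e0; exists d => // h hd.
  by rewrite mul0r subr0 (le_trans (hu _ _))// H.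
have h1 : complex.Re (phi (1%:C * z)) = complex.Re (phi (0%:C * z)).
  by apply: (cst (fun t => complex.Re (phi (t%:C * z)))) => x y; rewrite -ReB normc_Re.
have h2 : complex.Im (phi (1%:C * z)) = complex.Im (phi (0%:C * z)).
  by apply: (cst (fun t => complex.Im (phi (t%:C * z)))) => x y; rewrite -ImB normc_Im.
rewrite !(mul1r, mul0r) in h1 h2.
by apply/eqP; rewrite eq_complex h1 h2 !eqxx.
Qed.

(* [|1 - a^* z|^2 = |z - a|^2 + (1 - |z|^2) (1 - |a|^2)] *)
Lemma green_bound z a : normc z < 1 -> normc a < 1 -> z != a ->
  0 <= green z a <= ln (1 + (1 - normc z ^+ 2) / normc (z - a)).
Proof.
move=> z1 a1 za; have z0 := normc_ge0 z; have a0 := normc_ge0 a.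
have D0 : 0 < normc (z - a) by rewrite normc_gt0 subr_eq0.
have Da : normc z - normc a <= normc (z - a) by exact: normc_dist_ge.
have E : normc (1 - (a^*)%C * z) ^+ 2 =
    normc (z - a) ^+ 2 + (1 - normc z ^+ 2) * (1 - normc a ^+ 2).
  rewrite !normc_sqr; case: z {z1 za z0 D0 Da} => z1 z2; case: a {a1 a0} => a1 a2 /=; ring.
have w0 := normc_ge0 (1 - (a^*)%C * z).
rewrite /green normcM normcV.
move: (normc (1 - _)) w0 E => w w0 E.
move: (normc (z - a)) D0 Da E => D D0 Da E.
move: (normc z) (normc a) z1 a1 z0 a0 Da E => r t r1 t1 r0 t0 Da E.
have X0 : 0 <= 1 - r ^+ 2 by nra.
have wD : D <= w.
  rewrite -ler_sqr ?nnegrE ?(ltW D0)// E lerDl mulr_ge0//; nra.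
(* From [r - t <= D] follows [1 - t ^ 2 <= 1 - r ^ 2 + 2 * D], and then [E] is at most the square of
   [D + (1 - r ^ 2)]. *)
have w2 : w <= D + (1 - r ^+ 2).
  rewrite -ler_sqr ?nnegrE//; last by rewrite addr_ge0// ltW.
  have YX : 1 - t ^+ 2 <= 1 - r ^+ 2 + 2 * D by nra.
  have := ler_wpM2l X0 YX; rewrite E; nra.
have Di : 0 < D^-1 by rewrite invr_gt0.
have q1 : 1 <= w / D by rewrite ler_pdivlMr// mul1r.
rewrite ln_ge0//= ler_ln ?posrE.
- by rewrite ler_pdivrMr// mulrDl mul1r divfK ?gt_eqF.
- exact: lt_le_trans q1.
- by rewrite ltr_pwDl// mulr_ge0// ltW.
Qed.

(** For [T <= 1], [ln (1 + T) <= T <= T ^ beta]. For [T > 1], [ln (1 + T) <= ln 2 + ln T], and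
    [beta * ln T = ln (T ^ beta) <= T ^ beta]. *)
Lemma ln_powR_bound beta : 0 < beta -> beta < 1 -> forall T, 0 < T ->
  ln (1 + T) <= (1 + beta^-1) * T `^ beta.
Proof.
move=> b0 b1 T T0; have K1 : 1 <= 1 + beta^-1 by rewrite lerDl invr_ge0 ltW.
have lnle (x : R) : 0 < x -> ln (1 + x) <= x.
  by move=> x0; rewrite le_ln1Dx// (lt_trans _ x0)// ltrN10.
have [T1|T1] := leP T 1.
  apply: (le_trans (lnle _ T0)); apply: (@le_trans _ _ (T `^ beta)).
    by rewrite -[leLHS](powRr1 (ltW T0)); apply: ger_powR; rewrite ?T0// ltW.
  by rewrite ler_peMl ?powR_ge0.
have Tb : 1 <= T `^ beta by rewrite -[leLHS](powRr0 T) (ler_powR (ltW T1))// ltW.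
have h1 : ln (1 + T) <= ln 2 + ln T.
  rewrite -lnM ?posrE// ler_ln ?posrE ?mulr_gt0// ?addr_gt0//; lra.
have h2 : ln 2 <= 1 :> R by have := lnle 1 ltr01; rewrite -natr1.
have h3 : beta * ln T <= T `^ beta.
  by rewrite -ln_powR (le_trans _ (lnle _ (powR_gt0 beta T0)))// ler_ln ?posrE ?addr_gt0
    ?powR_gt0// lerDr.
rewrite (le_trans h1)// mulrDl mul1r lerD ?(le_trans h2)//.
by rewrite mulrC ler_pdivlMr// mulrC.
Qed.

Lemma dyadic_scale D : 0 < D -> D <= 2 -> exists j, (2 ^+ j)^-1 <= D <= 2 / 2 ^+ j.
Proof.
move=> D0 D2.
have ex : exists n, (2 ^+ n)^-1 <= D.
  have := cvg_geometric 1 (z := 2^-1 : R); rewrite ger0_norm// invf_lt1 ?ltr1n// => /(_ isT).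
  move/cvgrPdist_lt => /(_ _ D0) [n _ Hn]; exists n; have := Hn n (leqnn n).
  rewrite /geometric/= sub0r normrN mul1r exprVn ger0_norm//.
  by move/ltW.
case: (ex_minnP ex) => j jD jmin; exists j; rewrite jD /=.
case: j jD jmin => [|j] jD jmin; first by rewrite expr0 divr1.
rewrite exprS invfM mulrA divff// mul1r.
by rewrite leNgt; apply/negP => /ltW/jmin; rewrite ltnn.
Qed.

End Preliminaries.

Section FunctionSpaces.
Context {R : realType}.
Implicit Types (f g : R[i] -> R[i]) (z a : R[i]) (s sigma K C T p alpha L : R) (c : nat -> R).

(** The disc is cut by the level [k] of [1 - |z|] and the dyadic size [2 ^ -j] of [|z - a|]. On a
    cell the Green factor is at most [K (2 del_k) ^ sigma 2 ^ (sigma j)], against an area of order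
    [del_k 2 ^ -j]. Since [sigma < 1], the sum over [j] is geometric with a bound independent of
    [a]; the sum over [k] is the series bounded by [C]. *)
Lemma lacunary_Qspace f g (N : nat) c s sigma K C :
  (0 < N)%N -> 0 <= s -> 0 <= sigma < 1 -> 1 <= K -> (s = 0 -> sigma = 0) ->
  (forall T, 0 < T -> ln (1 + T) `^ s <= K * T `^ sigma) ->
  (forall z, normc z < 1 -> cdiff f z (g z)) ->
  (forall z, normc z < 1 -> exists k, (4 * N%:R ^+ k)^-1 <= 1 - normc z <= N%:R / N%:R ^+ k) ->
  (forall z k, normc z < 1 -> (4 * N%:R ^+ k)^-1 <= 1 - normc z -> normc (g z) <= 2 * c k) ->
  (forall n, \sum_(k < n) c k ^+ 2 * (N%:R ^+ k)^-1 `^ (1 + sigma) <= C) ->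
  Qspace s f.
Proof.
move=> N0 s0 /andP[sg0 sg1] K1 ssg lnK fg lev gc cC.
have N0' : 0 < N%:R :> R by rewrite ltr0n.
have K0 : 0 <= K := le_trans ler01 K1.
pose del k : R := N%:R / N%:R ^+ k.
have del0 k : 0 < del k by rewrite divr_gt0// exprn_gt0.
pose t : R := 2 `^ sigma / 2.
have t0 : 0 <= t by rewrite divr_ge0// powR_ge0.
have t1 : t < 1 by rewrite ltr_pdivrMr// mul1r -[ltRHS]powRr1// ltr_powR// ltr1n.
pose q k j : R := (2 * c k) ^+ 2 * (K * (2 * del k) `^ sigma * (2 `^ sigma) ^+ j).
pose m k j : R := 24 * del k * (2 / 2 ^+ j).
(* [192 = 4 * 24 * 2]: the square in [(2 * c k) ^+ 2] and the two constants in [m]. *)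
pose A : R := 192 * K * 2 `^ sigma * N%:R `^ (1 + sigma) * (1 - t)^-1.
have B0 : 0 <= 192 * K * 2 `^ sigma * N%:R `^ (1 + sigma).
  by apply: mulr_ge0; [apply: mulr_ge0; [exact: mulr_ge0|exact: powR_ge0]|exact: powR_ge0].
pose e k : R := A * (c k ^+ 2 * (N%:R ^+ k)^-1 `^ (1 + sigma)).
split.
  by move=> z z1; apply: cdiff_derivable (fg z z1).
apply: (@le_lt_trans _ _ ((pi^-1)%:E * (A * C)%:E)%E); last by rewrite -EFinM ltry.
apply: ge_ereal_sup => _ [a a1 <-]; rewrite /disc_integral.
apply: lee_wpmul2l; first by rewrite lee_fin invr_ge0 pi_ge0.
have /choice[S SP] : forall kj : nat * nat, exists S : set (R * R),
   [/\ measurable S, ((lebesgue_measure \x lebesgue_measure) S <= (m kj.1 kj.2)%:E)%E &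
    forall w, normc (w.1 +i* w.2) < 1 -> 1 - normc (w.1 +i* w.2) <= del kj.1 ->
      normc (w.1 +i* w.2 - a) <= 2 / 2 ^+ kj.2 -> S w].
  by move=> [k j]; apply: annulus_ball_cover; rewrite ?divr_ge0 ?exprn_ge0.
apply: (@integral_cover_le _ _ R (@lebesgue_measure R \x @lebesgue_measure R)%E _ _ (fun k j =>
  S (k, j)) q m e).
- by move=> w _; rewrite mulr_ge0 ?sqr_ge0 ?powR_ge0.
- by move=> k j; have [] := SP (k, j).
- by move=> k j; rewrite mulr_ge0 ?sqr_ge0// !mulr_ge0 ?powR_ge0 ?exprn_ge0 ?powR_ge0.
- move=> w wD; set z : R[i] := w.1 +i* w.2.
  have z1 : normc z < 1 by exact: wD.
  have a1' : normc a < 1 by [].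
  have [k /andP[k1 k2]] := lev z z1.
  have fz : normc (cderiv f z) ^+ 2 <= (2 * c k) ^+ 2.
    by rewrite (cdiff_cderiv (fg z z1)) lerXn2r ?nnegrE ?normc_ge0 ?(le_trans (normc_ge0 (g
      z)))// gc.
  have [za|za] := eqVneq z a.
    exists k, 0; split.
      have [_ _] := SP (k, 0); apply => //=.
      by rewrite -/z za subrr normc0 divr_ge0// exprn_ge0.
    rewrite ler_pM ?sqr_ge0 ?powR_ge0//.
    rewrite /green za subrr invr0 mulr0 normc0 ln0// expr0 mulr1.
    (* At [z = a] the total [green] is 0, and its power [s] is 0 unless [s = 0], when it is 1. In
       that case [sigma = 0] and the bound to compare with is [K], which is at least 1. *)
    have [s00|s00] := eqVneq s 0; last by rewrite powR0// mulr_ge0 ?powR_ge0.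
    by rewrite s00 (ssg s00) !powRr0 mulr1.
  have D0 : 0 < normc (z - a) by rewrite normc_gt0 subr_eq0.
  have D2 : normc (z - a) <= 2.
    by rewrite (le_trans (normcB_le z a))// -[2]/(1 + 1) lerD// ltW.
  have [j /andP[j1 j2]] := dyadic_scale D0 D2.
  exists k, j; split; first by have [_ _] := SP (k, j); apply.
  rewrite ler_pM ?sqr_ge0 ?powR_ge0//.
  have /andP[g0 gln] := green_bound z1 a1' za.
  have X0 : 0 < 1 - normc z ^+ 2.
    by rewrite subr_gt0 expr_lt1 ?normc_ge0.
  set T := _ / _ in gln.
  have T0 : 0 < T by rewrite divr_gt0.
  apply: (@le_trans _ _ (ln (1 + T) `^ s)).
    by rewrite ge0_ler_powR ?nnegrE// (le_trans g0).
  apply: (le_trans (lnK _ T0)); rewrite -mulrA ler_wpM2l//.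
  have XX : 1 - normc z ^+ 2 <= 2 * del k.
    have := normc_ge0 z; rewrite -/(del k) in k2; nra.
  have TT : T <= 2 * del k * 2 ^+ j.
    apply: ler_pM => //; [exact: ltW|by rewrite invr_ge0 ltW|].
    by rewrite -[leRHS]invrK lef_pV2 ?posrE// invr_gt0 exprn_gt0.
  have -> : (2 `^ sigma) ^+ j = (2 ^+ j) `^ sigma :> R.
    by rewrite -(powR_mulrn j (powR_ge0 _ _)) -(powR_mulrn j (ler0n R 2)) powRAC.
  rewrite -powRM ?exprn_ge0 ?mulr_ge0 ?(ltW (del0 k))//.
  by rewrite ge0_ler_powR ?nnegrE ?(ltW T0)// !mulr_ge0 ?exprn_ge0// ltW.
- by move=> k j; have [_ + _] := SP (k, j).
- move=> k J.
  have -> : \sum_(j < J) q k j * m k j =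
    (192 * K * 2 `^ sigma * N%:R `^ (1 + sigma) * (c k ^+ 2 * (N%:R ^+ k)^-1 `^ (1 + sigma))) *
      \sum_(j < J) t ^+ j.
    have dE : N%:R `^ (1 + sigma) * (N%:R ^+ k)^-1 `^ (1 + sigma) = del k * del k `^ sigma.
      rewrite -powRM ?invr_ge0 ?exprn_ge0 ?(ltW N0')// -/(del k) powRD ?powRr1 ?(ltW (del0 k))//.
      by rewrite (gt_eqF (del0 k)) implybT.
    rewrite mulr_sumr; apply: eq_bigr => j _.
    transitivity (192 * K * 2 `^ sigma * (del k * del k `^ sigma) * c k ^+ 2 * ((2 `^ sigma) ^+
      j / 2 ^+ j)).
      by rewrite /q /m powRM ?(ltW (del0 k))//; ring.
    by rewrite -dE /t expr_div_n; ring.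
  rewrite /e /A [leRHS]mulrAC; apply: ler_wpM2l; last exact: geometric_sum_le.
  by apply: mulr_ge0 => //; apply: mulr_ge0; [exact: sqr_ge0|exact: powR_ge0].
- move=> n; rewrite -mulr_sumr; apply: ler_wpM2l; last exact: cC.
  by apply: mulr_ge0 => //; rewrite invr_ge0 subr_ge0 ltW.
Qed.

(** The annuli [eta_k <= 1 - |z| <= 2 eta_k] are disjoint, and each contributes at least
    [M / (k + 1)] with [M] fixed: weight and area together give [eta_k ^ (1 + alpha)], which cancels
    the power of [N] in [c_k ^ p]. *)
Lemma lacunary_notin_weighted_Dirichlet f g (N : nat) c p alpha L :
  (513 <= N)%N -> 0 < p -> -1 < alpha -> 0 < L -> (forall k, 0 < c k) ->
  (forall z, normc z < 1 -> cdiff f z (g z)) ->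
  (forall z k, (4 * N%:R ^+ k)^-1 <= 1 - normc z <= 2 * (4 * N%:R ^+ k)^-1 -> L * c k <= normc
    (g z)) ->
  (forall k, c k `^ p = (N%:R ^+ k) `^ (1 + alpha) / k.+1%:R) ->
  ~ weighted_Dirichlet p alpha f.
Proof.
move=> N513 p0 alpha1 L0 c0 fg gc cp [_ fin].
have N0 : 0 < N%:R :> R by rewrite ltr0n (leq_trans _ N513).
pose eta k : R := (4 * N%:R ^+ k)^-1.
have eta0 k : 0 < eta k by rewrite invr_gt0 mulr_gt0// exprn_gt0.
have eta4 k : eta k <= 4^-1.
  rewrite lef_pV2 ?posrE ?mulr_gt0 ?exprn_gt0// ler_peMr// -natrX ler1n expn_gt0.
  by rewrite (leq_trans _ N513).
have etaS k i : 2 * eta (k + i.+1)%N < eta k.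
  have -> : eta (k + i.+1)%N = eta k * (N%:R ^+ i.+1)^-1 by rewrite /eta exprD mulrA invfM.
  rewrite mulrCA gtr_pMr ?eta0// ltr_pdivrMr ?exprn_gt0// mul1r -natrX ltr_nat.
  by rewrite (@leq_trans N) ?(leq_trans _ N513)// -{1}(expn1 N) leq_pexp2l// (leq_trans _ N513).
(* [1 - r ^ 2] lies between [eta k] and [4 * eta k]; the lower end decides for [alpha >= 0], the
   upper end for negative [alpha]. *)
pose kappa : R := Num.min 1 (4 `^ alpha).
have kappa0 : 0 < kappa by rewrite lt_min ltr01 powR_gt0.
have weight (r : R) k : 0 <= r -> eta k <= 1 - r <= 2 * eta k ->
    kappa * eta k `^ alpha <= (1 - r ^+ 2) `^ alpha.
  move=> r0 /andP[r1 r2]; have r3 : r <= 1 by have := eta0 k; lra.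
  have e0 := eta0 k.
  have x1 : eta k <= 1 - r ^+ 2 by nra.
  have x2 : 1 - r ^+ 2 <= 4 * eta k by nra.
  have [a0|/ltW a0] := leP 0 alpha.
    apply: (@le_trans _ _ (eta k `^ alpha)); last first.
      by rewrite ge0_ler_powR ?nnegrE ?(ltW e0) ?(le_trans (ltW e0) x1).
    by rewrite ler_piMl ?powR_ge0// ge_min lexx.
  apply: (@le_trans _ _ ((4 * eta k) `^ alpha)).
    by rewrite powRM ?(ltW e0)// ler_wpM2r ?powR_ge0// ge_min lexx orbT.
  rewrite -(opprK alpha) !(powRN _ (- alpha)) lef_pV2 ?posrE ?powR_gt0 ?mulr_gt0 ?(lt_le_trans
    e0 x1)//.
  by rewrite ge0_ler_powR ?nnegrE ?oppr_ge0 ?mulr_ge0 ?(ltW e0) ?(le_trans (ltW e0) x1).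
have /choice[B BP] : forall k, exists B : set (R * R),
  [/\ measurable B, ((eta k / 4)%:E <= (lebesgue_measure \x lebesgue_measure) B)%E &
    forall w, B w -> eta k <= 1 - normc (w.1 +i* w.2) <= 2 * eta k].
  by move=> k; exact: annulus_strip.
pose q k : R := kappa * eta k `^ alpha * (L * c k) `^ p.
have disc_lt (r : R) k : eta k <= 1 - r -> r < 1.
  by have := eta0 k; lra.
have key := @integral_disjoint_ge _ _ R (@lebesgue_measure R \x @lebesgue_measure R)%E
  [set w : R * R | unit_disc (w.1 +i* w.2)]
  (fun w => (1 - normc (w.1 +i* w.2) ^+ 2) `^ alpha * normc (cderiv f (w.1 +i* w.2)) `^ p)
  B q (fun k => eta k / 4).
have {}key (K : nat) : ((\sum_(k < K) q k * (eta k / 4))%:E <= \int[(@lebesgue_measure R \x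
  @lebesgue_measure R)%E]_(w in
        [set w : R * R | unit_disc (w.1 +i* w.2)]) ((1 - normc (w.1 +i* w.2) ^+ 2) `^ alpha *
          normc (cderiv f (w.1 +i* w.2)) `^ p)%:E)%E.
  apply: key.
  - by move=> w _; rewrite mulr_ge0 ?powR_ge0.
  - by move=> k; have [] := BP k.
  - by move=> k w Bw; have [_ _ /(_ _ Bw)/andP[h _]] := BP k; exact: disc_lt h.
  - move=> i j _ _ [w [Bi Bj]].
    have [_ _ /(_ _ Bi)/andP[i1 i2]] := BP i; have [_ _ /(_ _ Bj)/andP[j1 j2]] := BP j.
    case: (ltngtP i j) => // ij.
      have lt_ij := etaS i (j - i.+1)%N; rewrite -subSn// subSS subnKC ?(ltnW ij)// in lt_ij.
      by have := lt_le_trans (le_lt_trans j2 lt_ij) i1; rewrite ltxx.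
    have lt_ji := etaS j (i - j.+1)%N; rewrite -subSn// subSS subnKC ?(ltnW ij)// in lt_ji.
    by have := lt_le_trans (le_lt_trans i2 lt_ji) j1; rewrite ltxx.
  - by move=> k; rewrite mulr_ge0 ?powR_ge0// mulr_ge0 ?powR_ge0// ltW.
  - move=> k w Bw; have [_ _ /(_ _ Bw) h] := BP k.
    have z1 := disc_lt _ _ (andP h).1.
    rewrite ler_pM ?mulr_ge0 ?powR_ge0 ?(ltW kappa0)//; first exact: weight (normc_ge0 _) h.
    rewrite (cdiff_cderiv (fg _ z1)) ge0_ler_powR ?nnegrE ?normc_ge0 ?(ltW p0)//.
      by rewrite mulr_ge0// ltW.
    exact: gc h.
  - by move=> k; have [] := BP k.
pose M : R := kappa * L `^ p / 4 * 4^-1 `^ (1 + alpha).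
have M0 : 0 < M by rewrite !mulr_gt0 ?powR_gt0// invr_gt0.
have termE k : q k * (eta k / 4) = M * k.+1%:R^-1.
  rewrite /q powRM ?(ltW L0) ?(ltW (c0 _))// cp.
  have eE : eta k `^ alpha * eta k * (N%:R ^+ k) `^ (1 + alpha) = 4^-1 `^ (1 + alpha).
    rewrite mulrC -[X in _ * (_ * X)](powRr1 (ltW (eta0 k))) -powRD; last by rewrite (gt_eqF
      (eta0 k)) implybT.
    rewrite (addrC alpha) -powRM ?exprn_ge0 ?(ltW (eta0 k)) ?(ltW N0)//.
    by rewrite /eta invfM mulrCA divff ?mulr1// expf_neq0// gt_eqF.
  by rewrite /M -eE; ring.
move: fin; rewrite /disc_integral; set I := integral _ _ _ => fin.
have I0 : (0 <= I)%E by apply: integral_ge0 => w _; rewrite lee_fin mulr_ge0 ?powR_ge0.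
have ipi : 0 < (pi : R)^-1 by rewrite invr_gt0 pi_gt0.
have Ifin : I \is a fin_num.
  rewrite ge0_fin_numE//; move: fin; case: (I) => [r|//|//]; rewrite ?ltry//.
  by rewrite gt0_muley ?lte_fin.
have bound (K : nat) : series (@harmonic R) K <= fine I / M.
  rewrite ler_pdivlMr// -lee_fin fineK//; apply: le_trans (key K).
  rewrite lee_fin /series /= big_mkord mulr_suml.
  by apply: ler_sum => k _; rewrite termE mulrC /harmonic.
apply: (@dvg_harmonic R); apply: nondecreasing_is_cvgn.
  by apply: nondecreasing_series => k _ _; rewrite /harmonic /= invr_ge0.
by exists (fine I / M) => _ [K _ <-].
Qed.

End FunctionSpaces.

(** * Levels of the disc, choice of [sigma], and the local behaviour of [phi] *)

Section Assembly.
Context {R : realType}.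
Implicit Types (z a : R[i]) (s p alpha beta sigma : R).

(** [k] is the least index satisfying the lower bound. For [k > 0] minimality gives
    [1 - |z| < 1 / (4 N ^ (k - 1))]; the numerator [N] also accommodates [k = 0], so the levels
    exhaust the disc. *)
Lemma disc_level (N : nat) z : (1 < N)%N -> normc z < 1 ->
  exists k, (4 * N%:R ^+ k)^-1 <= 1 - normc z <= N%:R / N%:R ^+ k.
Proof.
move=> N1 z1; have N0 : 0 < N%:R :> R by rewrite ltr0n ltnW.
have z10 : 0 < 1 - normc z by rewrite subr_gt0.
have ex : exists n, (4 * N%:R ^+ n)^-1 <= 1 - normc z.
  have := cvg_geometric (1 : R) (z := (N%:R)^-1 : R).
  rewrite ger0_norm ?invr_ge0 ?(ltW N0)// invf_lt1// ltr1n => /(_ N1).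
  move/cvgrPdist_lt => /(_ _ z10) [n _ Hn]; exists n; have := Hn n (leqnn n).
  rewrite /geometric/= sub0r normrN mul1r exprVn ger0_norm ?invr_ge0 ?exprn_ge0 ?(ltW N0)//.
  move=> /ltW; apply: le_trans; rewrite invfM ler_piMl ?invr_ge0 ?exprn_ge0 ?(ltW N0)//.
  by rewrite invf_le1 ?ler1n.
case: (ex_minnP ex) => k kz kmin; exists k; rewrite kz /=.
case: k kz kmin => [|k] kz kmin.
  rewrite expr0 divr1; apply: (@le_trans _ _ 1); first by rewrite lerBlDr lerDl normc_ge0.
  by rewrite ler1n ltnW.
have Nk : 0 < N%:R ^+ k :> R by rewrite exprn_gt0.
rewrite exprS invfM mulrA divff ?gt_eqF// mul1r.
have [/kmin|/ltW] := leP (4 * N%:R ^+ k)^-1 (1 - normc z); first by rewrite ltnn.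
by move=> /le_trans; apply; rewrite lef_pV2 ?posrE ?mulr_gt0// ler_peMl ?(ltW Nk)// ler1n.
Qed.

(* For [s = 1] the exponent is lowered to [beta < 1]: this makes
   [|z - a| ^ - sigma] integrable over lines, at no cost since the summability
   condition is then strict. *)
Lemma log_exponent s p alpha : 0 <= s <= 1 -> 0 < p -> -1 < alpha -> alpha < p - 1 ->
  (alpha < p * (s + 1) / 2 - 1 \/ (p < 2 /\ alpha = p * (s + 1) / 2 - 1)) ->
  exists sigma K, [/\ 0 <= sigma < 1, 1 <= K, s = 0 -> sigma = 0,
    2 * ((1 + alpha) / p) < 1 + sigma \/ (p < 2 /\ 2 * ((1 + alpha) / p) = 1 + sigma) &
    forall T : R, 0 < T -> ln (1 + T) `^ s <= K * T `^ sigma].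
Proof.
move=> /andP[s0 s1] p0 a1 ap hc.
set beta := (1 + alpha) / p.
have b0 : 0 < beta by rewrite divr_gt0//; lra.
have b1 : beta < 1 by rewrite ltr_pdivrMr//; lra.
have [s_eq1|s_neq1] := eqVneq s 1.
  exists beta, (1 + beta^-1); split.
  - by rewrite ltW.
  - by rewrite lerDl invr_ge0 ltW.
  - by move=> h; move: s_eq1; rewrite h => /eqP; rewrite eq_sym oner_eq0.
  - by left; lra.
  - move=> T T0; rewrite s_eq1 powRr1; first exact: ln_powR_bound.
    by rewrite ln_ge0// lerDl ltW.
have s_lt1 : s < 1 by rewrite lt_neqAle s_neq1.
exists s, 1; split => //.
- by rewrite s0.
- case: hc => [h|[p2 h]]; [left|right; split => //].
    by rewrite /beta mulrA ltr_pdivrMr//; lra.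
  by rewrite /beta h; field; rewrite gt_eqF.
- move=> T T0; rewrite mul1r ge0_ler_powR ?nnegrE ?(ltW T0)//.
    by rewrite ln_ge0// lerDl ltW.
  by rewrite le_ln1Dx// (lt_trans _ T0)// ltrN10.
Qed.

Lemma superposition_cst (phi : R[i] -> R[i]) c p alpha f : p != 0 ->
  (forall z, phi z = c) -> weighted_Dirichlet p alpha (superposition phi f).
Proof.
move=> p0 phic.
have cd z : cdiff (superposition phi f) z 0.
  move=> e e0; exists 1 => // h _; rewrite /superposition /= !phic subrr mul0r subr0 normc0.
  by rewrite mulr_ge0 ?normc_ge0// ltW.
split; first by move=> z _; exact: cdiff_derivable (cd z).
rewrite /disc_integral integral0_eq ?mule0 ?ltry//.
by move=> w _; rewrite (cdiff_cderiv (cd _)) normc0 powR0// mulr0.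
Qed.

Lemma cderiv_bounded_below (phi : R[i] -> R[i]) : entire phi ->
  ~ (exists c, forall z, phi z = c) ->
  exists (c : R[i]) (r L : R), [/\ 0 < r, 0 < L & forall z, normc (z - c) < r -> L <= normc
    (cderiv phi z)].
Proof.
move=> phiE ncst; have half (x y : R) : x - y <= x / 2 -> x / 2 <= y by lra.
have [c hc] : exists c, cderiv phi c != 0.
  apply: contrapT => /forallNP h; apply: ncst; exists (phi 0).
  by apply: entire_cderiv0_cst => // z; apply/eqP/negPn/negP/h.
have L0 : 0 < normc (cderiv phi c) / 2 by rewrite divr_gt0// normc_gt0.
have [r r0 hr] := entire_cderiv_continuous c phiE L0.
exists c, r, (normc (cderiv phi c) / 2); split => // z /hr.
rewrite normc_distC => /(le_trans (normc_dist_ge _ _)); exact: half.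
Qed.

End Assembly.

Unset Implicit Arguments.
Set Strict Implicit.
Set Printing Implicit Defensive.

Theorem theorem8 (R : realType) (phi : R[i] -> R[i]) (s p alpha : R)
    (hphi : entire phi) (hs : 0 <= s <= 1) (hp : 0 < p) (halpha : -1 < alpha)
    (hpa : p - 2 < alpha < p - 1)
    (hcond : alpha < p * (s + 1) / 2 - 1 \/
             (p < 2 /\ alpha = p * (s + 1) / 2 - 1)) :
  (superposition phi @` Qspace s `<=` weighted_Dirichlet p alpha) <->
  (exists c : R[i], forall z : R[i], phi z = c).
Proof.
split; last first.
  by move=> [c phic] _ [f _ <-]; apply: superposition_cst phic; rewrite gt_eqF.
move=> sub; apply: contrapT => /(cderiv_bounded_below hphi)[b [r [L [r0 L0 phiL]]]].
have /andP[_ ap] := hpa; have /andP[s0 _] := hs.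
have [sigma [K [sg K1 ssg bs lnK]]] := log_exponent hs hp halpha ap hcond.
have b0 : 0 < (1 + alpha) / p by rewrite divr_gt0//; lra.
have b1 : (1 + alpha) / p < 1 by rewrite ltr_pdivrMr//; lra.
have [N [c [v [C [N513 c0 c_lo c_hi [v0 v1 c_v c_p c_sum]]]]]] := lacunary_coefficients hp b0 b1
  bs.
have [f [g [fg fB gc]]] := lacunary_ex N513 c0 c_lo c_hi v0 v1 c_v.
have N1 : (1 < N)%N by rewrite (leq_trans _ N513).
have N0 : 0 < N%:R :> R by rewrite ltr0n ltnW.
have v10 : 0 < (1 - v)^-1 by rewrite invr_gt0 subr_gt0.
(* The cap by 1 preserves the upper bounds on [g]; the other entry keeps the values of [f0] within
   distance [r] of [b]. *)
pose e : R := Num.min 1 (r / 2 / (1 - v)^-1).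
have e0 : 0 < e by rewrite lt_min ltr01 !divr_gt0.
have e1 : e <= 1 by rewrite ge_min lexx.
have eB : e * (1 - v)^-1 < r.
  apply: (@le_lt_trans _ _ (r / 2)); last by lra.
  by rewrite -ler_pdivlMr// ge_min lexx orbT.
pose f0 z := e%:C * f z + b.
have f0g z : normc z < 1 -> cdiff f0 z (e%:C * g z).
  by move=> /fg h; exact: (cdiff_comp h (cdiff_affine e%:C b _)).
have ne : normc (e%:C : R[i]) = e by rewrite normc_real gtr0_norm.
have normc_term z k : normc ((c k)%:C * z ^+ (N ^ k)) = c k * normc z ^+ (N ^ k).
  by rewrite normcM normc_real normcX gtr0_norm.
have Qf : Qspace s f0.
  apply: (@lacunary_Qspace R f0 _ N c s sigma K C (ltnW N1) s0 sg K1 ssg lnK f0g) => //.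
  - by move=> z; exact: disc_level.
  - move=> z k z1 zk; rewrite normcM ne.
    have h1 := gc z k z1 zk.
    have h2 : normc ((c k)%:C * z ^+ (N ^ k)) <= c k.
      by rewrite normc_term ler_piMr ?(ltW (c0 k))// exprn_ile1 ?normc_ge0// ltW.
    have h3 := normc_dist_ge (g z) ((c k)%:C * z ^+ (N ^ k)).
    have ck := c0 k.
    apply: (@le_trans _ _ (normc (g z))); first by rewrite ler_piMl ?normc_ge0.
    lra.
have : weighted_Dirichlet p alpha (superposition phi f0) by apply: sub; exists f0.
apply: (@lacunary_notin_weighted_Dirichlet R _ (fun z => cderiv phi (f0 z) * (e%:C * g z)) N c p
  alpha (L * e / 4)) => //.
- by rewrite !mulr_gt0// invr_gt0.
- by move=> z z1; apply: cdiff_comp (f0g z z1) _; exact: entire_cdiff.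
- move=> z k /andP[k1 k2].
  have n0 : 0 < (4 * N%:R ^+ k)^-1 :> R by rewrite invr_gt0 mulr_gt0// exprn_gt0.
  have z1 : normc z < 1 by lra.
  have h1 := gc z k z1 k1.
  (* Here [1 - |z| <= 1 / (2 N ^ k)], so Bernoulli's inequality gives [|z| ^ (N ^ k) >= 1 / 2]. The
     leading term then exceeds the remainder, at most [c k / 4], by at least [c k / 4]. *)
  have h2 : c k / 2 <= normc ((c k)%:C * z ^+ (N ^ k)).
    rewrite normc_term ler_wpM2l ?(ltW (c0 k))//.
    apply: le_trans (bernoulli _ (normc_ge0 z) (ltW z1)).
    have : (N ^ k)%:R * (1 - normc z) <= 2^-1.
      rewrite natrX -ler_pdivlMl ?exprn_gt0//; apply: (le_trans k2).
      by rewrite invfM mulrA -[leRHS]mulrC ler_wpM2r ?invr_ge0 ?exprn_ge0 ?(ltW N0)//; lra.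
    lra.
  have h3 := normc_dist_ge ((c k)%:C * z ^+ (N ^ k)) (g z).
  rewrite normc_distC in h3.
  have h4 : c k / 4 <= normc (g z) by lra.
  have h5 : L <= normc (cderiv phi (f0 z)).
    apply: phiL; rewrite /f0 addrK normcM ne (le_lt_trans _ eB)//.
    by rewrite ler_wpM2l ?(ltW e0)// fB.
  rewrite !normcM ne -!mulrA; apply: ler_pM => //; rewrite ?mulr_ge0 ?invr_ge0 ?(ltW L0) ?(ltW
    e0) ?(ltW (c0 k))//.
  by rewrite ler_wpM2l ?(ltW e0)// mulrC.
- by move=> k; rewrite c_p (mulrCA p) divff ?mulr1// gt_eqF.
Qed.
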